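(* Let $(H_i)_{i\in I}$ be a collection of binary hypothesis classes with $H_i\subseteq\{-1,1,*\}^X$ for each $i\in I$. For any $\varepsilon,\delta\in(0,1/4)$, \[ \#\mathsf{AgreeL}((H_i)_{i\in I},\varepsilon,\delta)=O\!\left(\frac{\mathsf{VC}((H_i)_{i\in I})}{\varepsilon^2}\log_+^2\!\left(\frac{\mathsf{VC}((H_i)_{i\in I})}{\varepsilon}\right)+\frac1{\varepsilon^2}\log\!\left(\frac1\delta\right)\right), \] and when $\mathsf{VC}((H_i)_{i\in I})\ge1$, \[ \#\mathsf{AgreeL}((H_i)_{i\in I},\varepsilon,\delta)=\Omega\!\left(\frac{\mathsf{VC}((H_i)_{i\in I})}{\varepsilon^2}+\frac1{\varepsilon^2}\log\!\left(\frac1\delta\right)\right). \]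
   Context: $X$ non-empty; distributions discrete. $\mathsf{VC}((H_i)_{i\in I})$ is the supremum of $|X'|$ over $X'\subseteq X$ shattered by every $H_i$ (shattered: every $\xi:X'\to\{-1,1\}$ agrees on $X'$ with some member of the class). Agreement learning $\mathsf{AgreeL}_n((H_i)_{i\in I},\varepsilon,\delta)$: (possibly randomized) learners taking $n$ points of $X\times\{-1,1\}$ and outputting $f:X\to\{-1,1\}$ such that for every distribution $\mu$ on $X\times\{-1,1\}$, given $n$ i.i.d. samples, with probability $\ge1-\delta$, $\Pr_\mu[f(x)=y]\ge\sup_{(h_i)_{i\in I}\in\prod_{i}H_i}\Pr_\mu[\forall i\in I,\ y=h_i(x)]-\varepsilon$. $\#\mathsf{AgreeL}$ is the least such $n$. $\log_+(u)=\log_2\max\{2,u\}$. *)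

(* Defs.v *)
From HB Require Import structures.
From mathcomp Require Import all_boot all_order all_algebra.
From mathcomp Require Import all_classical all_reals.
From mathcomp Require Import ereal esum exp.
From mathcomp Require Import Rstruct.
From Stdlib Require Import Rdefinitions.

Set Implicit Arguments.
Unset Strict Implicit.
Unset Printing Implicit Defensive.

Import Order.TTheory GRing.Theory Num.Theory.
Local Open Scope classical_set_scope.
Local Open Scope ring_scope.

(* Labels: {-1,1} is encoded as bool (true = 1, false = -1);
   partial labels {-1,1,*} as option bool (None = * ). *)

Definition dsum (T : Type) (A : set T) (f : T -> \bar R) : \bar R :=
  esum (A : set {classic T}) f.

Definition is_dist (T : Type) (p : T -> R) : Prop :=
  (forall t, 0 <= p t) /\ dsum setT (fun t => (p t)%:E) = 1%E.

Definition Pr (T : Type) (p : T -> R) (E : set T) : \bar R :=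
  dsum E (fun t => (p t)%:E).

Definition iid (T : Type) (n : nat) (p : T -> R) (S : 'I_n -> T) : R :=
  \prod_(k < n) p (S k).

Definition best_agreement (X I : Type) (H : I -> set (X -> option bool))
    (mu : X * bool -> R) : \bar R :=
  ereal_sup [set Pr mu [set z | forall i, h i z.1 = Some z.2]
            | h in [set h : I -> X -> option bool | forall i, H i (h i)]].

(* A (possibly randomized) learner using n samples: for each sample S it
   outputs a hypothesis f : X -> {-1,1} drawn from a discrete distribution
   A S.  It is an agreement learner for (H, eps, delta) if for every discrete
   distribution mu on X * {-1,1}, with probability >= 1 - delta (jointly over
   the n i.i.d. samples and the learner's randomness) the output f satisfies
   Pr_mu[f x = y] >= sup_h Pr_mu[forall i, y = h_i x] - eps. *)
Definition agree_learner (X I : Type) (H : I -> set (X -> option bool))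
    (eps delta : R) (n : nat)
    (A : ('I_n -> X * bool) -> (X -> bool) -> R) : Prop :=
  (forall S, is_dist (A S)) /\
  forall mu : X * bool -> R, is_dist mu ->
    (Pr (fun Sf : ('I_n -> X * bool) * (X -> bool) => (iid mu Sf.1 * A Sf.1 Sf.2)%R)
       [set Sf | (Pr mu [set z | Sf.2 z.1 = z.2]
                  >= best_agreement H mu - eps%:E)%E]
     >= (1 - delta)%:E)%E.

(* n samples suffice: n is in the set whose least element is #AgreeL. *)
Definition AgreeL_n (X I : Type) (H : I -> set (X -> option bool))
    (eps delta : R) (n : nat) : Prop :=
  exists A, @agree_learner X I H eps delta n A.

Definition shattered_by_all (X I : Type) (H : I -> set (X -> option bool))
    (d : nat) (e : 'I_d -> X) : Prop :=
  injective e /\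
  forall (xi : 'I_d -> bool) (i : I),
    exists h, H i h /\ forall k, h (e k) = Some (xi k).

Definition VC (X I : Type) (H : I -> set (X -> option bool)) : \bar R :=
  ereal_sup [set (d%:R)%:E | d in [set d : nat |
                   exists e : 'I_d -> X, shattered_by_all H e]].

Definition logp (u : R) : R := ln (Num.max 2 u) / ln 2.

(* Main.v *)
(** Only the labelings agreed upon by a tuple [(h_i)] matter, so the problem is agnostic
    learning of one class of partial functions, which shatters exactly the sets shattered by
    every [H_i].

    Upper bound.  Partial classes have no uniform convergence; instead one compresses.  On [k]
    realizable examples, the online predictor that takes a majority vote over the consistent
    patterns errs at most [log_2] of the number of patterns times, which Pajor's lemma bounds
    by [k / 4] when [k = 56 d].  By exchangeability, for every weighting of the sample some such
    predictor, described by [k] sample indices and a position, has error at most [1 / 4], and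
    boosting [O(log n)] of them classifies any realizable part of the sample correctly.  The
    learner is empirical risk minimization over the hypotheses described by such codes; it
    generalizes by a union bound over codes and Chernoff's bound on the examples that the code
    does not mention.

    Lower bound.  On a shattered set, a uniformly chosen point receives a label with bias
    [eps] (one point, for the confidence term) or [2 eps] ([d] points, averaging over all sign
    patterns); both are cases of Le Cam's two-point inequality. *)
Require Import Defs.
From Stdlib Require Import Rdefinitions.
From HB Require Import structures.
From mathcomp Require Import all_boot all_order all_algebra.
From mathcomp Require Import zify ring lra.
Import Order.TTheory GRing.Theory Num.Theory.
Set Implicit Arguments.
Unset Strict Implicit.
Unset Printing Implicit Defensive.
Local Open Scope ring_scope.

(** * Pajor's lemma *)

Definition shatters (T : finType) (F : {set {ffun T -> bool}}) (A : {set T}) :=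
  [forall xi : {ffun T -> bool}, exists b in F, forall s in A, b s == xi s].

Lemma shattersP (T : finType) (F : {set {ffun T -> bool}}) (A : {set T}) :
  reflect (forall xi : {ffun T -> bool},
             exists2 b, b \in F & forall s, s \in A -> b s = xi s)
          (shatters F A).
Proof.
apply: (iffP forallP) => [sh xi|sh xi].
  have /existsP[b /andP[bF /forallP bA]] := sh xi.
  by exists b => // s sA; have /implyP/(_ sA)/eqP := bA s.
have [b bF bA] := sh xi; apply/existsP; exists b; rewrite bF /=.
by apply/forallP => s; apply/implyP => /bA ->.
Qed.

Lemma shattersS (T : finType) (F G : {set {ffun T -> bool}}) (A : {set T}) :
  F \subset G -> shatters F A -> shatters G A.
Proof.
move=> /subsetP FG /shattersP sh; apply/shattersP => xi.
by have [b bF bA] := sh xi; exists b => //; apply: FG.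
Qed.

Lemma shatters_fixed (T : finType) (F : {set {ffun T -> bool}}) (A : {set T})
    (x : T) (v : bool) :
  (forall b, b \in F -> b x = v) -> shatters F A -> x \notin A.
Proof.
move=> Fx /shattersP /(_ [ffun=> ~~ v]) [b /Fx bx bA].
by apply/negP => /bA; rewrite bx ffunE; case: (v).
Qed.

(** Induction on [#|F|]: split [F] by the value at a coordinate [x] where two members differ.
    Neither half shatters a set containing [x], and a set shattered by both halves remains shattered
    by [F] after [x] is added, so the counts for the halves add up. *)
Lemma pajor (T : finType) (F : {set {ffun T -> bool}}) :
  (#|F| <= #|[set A : {set T} | shatters F A]|)%N.
Proof.
have [m] := ubnP #|F|; elim: m F => // m IH F /ltnSE Fm.
have [F1|] := leqP #|F| 1.
  have [->|[b bF]] := set_0Vmem F; first by rewrite cards0.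
  apply: leq_trans F1 _; apply/card_gt0P; exists set0; rewrite inE.
  by apply/shattersP => xi; exists b => // s; rewrite inE.
case/card_gt1P => b0 [b1 [b0F b1F]].
move=> b01.
have [x bx|b01E] := pickP (fun x => b0 x != b1 x); last first.
  by case/eqP: b01; apply/ffunP => x; apply/eqP/negPn; rewrite b01E.
pose G v := [set b in F | b x == v].
have GF v : G v \subset F by apply/subsetP => b; rewrite inE => /andP[].
have Gx v b : b \in G v -> b x = v by rewrite inE => /andP[_ /eqP].
pose sh v := [set A : {set T} | shatters (G v) A].
have cF : #|F| = (#|G true| + #|G false|)%N.
  rewrite -(cardsID [set b : {ffun T -> bool} | b x] F); congr addn.
    by apply: eq_card => b; rewrite !inE eqb_id andbC.
  by apply: eq_card => b; rewrite !inE eqbF_neg andbC.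
have Gn v : (#|G v| > 0)%N.
  apply/card_gt0P.
  have [<-|] := eqVneq (b0 x) v; first by exists b0; rewrite inE b0F /=.
  by move=> h; exists b1; rewrite inE b1F /=; move: bx h; case: (b0 x); case: (b1 x); case: v.
have IHt v : (#|G v| <= #|sh v|)%N.
  by apply: IH; move: cF (Gn true) (Gn false) Fm; case: v; lia.
have xsh v A : A \in sh v -> x \notin A.
  by rewrite inE; apply: (shatters_fixed (@Gx v)).
(* A set shattered by both halves is counted twice in the sum; [B] supplies its second copy. *)
pose B := [set x |: A | A in sh true :&: sh false].
have dis : [disjoint sh true :|: sh false & B].
  rewrite disjoints_subset; apply/subsetP => A; rewrite inE => AU.
  rewrite inE; apply/negP => /imsetP[A' _ AE].
  have : x \in A by rewrite AE setU11.
  by apply/negP; case/orP: AU => /xsh.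
have subU : (sh true :|: sh false) :|: B \subset [set A | shatters F A].
  apply/subsetP => A /setUP[/setUP[]|].
  - by rewrite !inE; apply: shattersS.
  - by rewrite !inE; apply: shattersS.
  case/imsetP => A' /setIP[A't A'f] ->; rewrite inE.
  apply/shattersP => xi.
  have: A' \in sh (xi x) by case: (xi x).
  rewrite inE => /shattersP /(_ xi) [b bG bA].
  exists b; first exact: (subsetP (GF _)) _ bG.
  by move=> s /setU1P[->|/bA //]; apply: Gx bG.
rewrite cF; apply: leq_trans (subset_leq_card subU).
rewrite cardsU (disjoint_setI0 dis) cards0 subn0.
have -> : #|B| = #|sh true :&: sh false|.
  apply: card_in_imset => A A' /setIP[/xsh xA _] /setIP[/xsh xA' _] AE.
  by rewrite -(setU1K xA) AE setU1K.
by rewrite cardsUI leq_add.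
Qed.

(** By the binomial theorem [8 ^ k = (7 + 1) ^ k] is the sum of [7 ^ (k - #|A|)] over all sets [A],
    and each set of size at most [d] contributes at least [7 ^ (k - d)]. *)
Lemma card_small_sets (k d : nat) : (d <= k)%N ->
  (7 ^ (k - d) * #|[set A : {set 'I_k} | #|A| <= d]| <= 8 ^ k)%N.
Proof.
move=> dk.
have -> : (8 ^ k = \sum_(A : {set 'I_k}) 7 ^ (k - #|A|))%N.
  rewrite (partition_big (fun A : {set 'I_k} => inord #|A| : 'I_k.+1) predT) //=.
  rewrite -[8%N]/(7 + 1)%N expnDn; apply: eq_bigr => i _.
  rewrite exp1n muln1 -[k in 'C(k, _)]card_ord -card_draws -sum1_card big_distrl /=.
  have Ak (A : {set 'I_k}) : (#|A| < k.+1)%N.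
    by rewrite ltnS -[X in (_ <= X)%N]card_ord max_card.
  apply: eq_big => [A|A].
    by rewrite inE -val_eqE /= inordK.
  by rewrite inE => /eqP ->; rewrite mul1n.
rewrite -sum1_card big_distrr /= [X in (_ <= X)%N](bigID (mem [set A : {set 'I_k} | #|A| <= d]%N)) /=.
apply: leq_trans (leq_addr _ _); apply: leq_sum => A; rewrite inE => Ad.
by rewrite muln1 leq_exp2l // leq_sub2l.
Qed.

(** This fixes the choice [k = 56 d]. The claim reduces to [8 ^ 56 <= 2 ^ 14 * 7 ^ 55]; dividing by
    [2 ^ 14] and taking eleventh roots leaves [2 ^ 14 = 16384 <= 16807 = 7 ^ 5]. *)
Lemma pow_bound (d M : nat) :
  (2 ^ M * 7 ^ (56 * d - d) <= 8 ^ (56 * d))%N -> (4 * M <= 56 * d)%N.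
Proof.
move=> h; rewrite leqNgt; apply/negP => dM.
have dM' : (14 * d < M)%N by lia.
have : (2 ^ (14 * d) * 7 ^ (55 * d) < 8 ^ (56 * d))%N.
  apply: leq_trans h.
  have -> : (56 * d - d = 55 * d)%N by lia.
  by rewrite ltn_pmul2r ?expn_gt0 // ltn_exp2l.
apply/negP; rewrite -leqNgt !expnM -expnMn.
have mono m n : (m <= n)%N -> (m ^ d <= n ^ d)%N.
  by case: d {h dM dM'} => // d; rewrite leq_exp2r.
apply: mono.
have e8 : (8 ^ 56 = 2 ^ 14 * (2 ^ 14) ^ 11)%N.
  rewrite -[8%N]/(2 ^ 3)%N -!expnM -expnD; congr (_ ^ _)%N.
have e7 : (7 ^ 55 = (7 ^ 5) ^ 11)%N by rewrite -expnM; congr (_ ^ _)%N.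
rewrite e8 e7 leq_mul2l leq_exp2r; [apply/orP; right | by []].
have -> : (2 ^ 14 = (2 ^ 7) * (2 ^ 7))%N by rewrite -expnD.
have -> : (7 ^ 5 = 343 * 49)%N by rewrite -[343%N]/(7 ^ 3)%N -[49%N]/(7^2)%N -expnD.
by rewrite -[(2 ^ 7)%N]/128%N; lia.
Qed.

From mathcomp Require Import all_classical all_reals.
From mathcomp Require Import ereal esum sequences exp.
From mathcomp Require Import Rstruct.
Import Order.TTheory GRing.Theory Num.Theory.
Local Open Scope ring_scope.

(** * Halving predictors *)

(** The halving algorithm of online learning, with [V] the version space at time [t]; a tie predicts
    [true]. *)
Definition vote (k : nat) (F : {set {ffun 'I_k -> bool}}) (lab : 'I_k -> bool)
    (t : 'I_k) : bool :=
  let V := finset (fun b : {ffun 'I_k -> bool} =>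
    (b \in F) && [forall s : 'I_k, (s < t)%N ==> (b s == lab s)]) in
  (#|V| <= 2 * #|finset (fun b => (b \in V) && b t)|)%N.

Lemma vote_ext (k : nat) (F : {set {ffun 'I_k -> bool}}) (lab lab' : 'I_k -> bool)
    (t : 'I_k) :
  (forall s : 'I_k, (s < t)%N -> lab s = lab' s) -> vote F lab t = vote F lab' t.
Proof.
move=> E; rewrite /vote.
have -> // : finset (fun b : {ffun 'I_k -> bool} =>
    (b \in F) && [forall s : 'I_k, (s < t)%N ==> (b s == lab s)]) =
  finset (fun b : {ffun 'I_k -> bool} =>
    (b \in F) && [forall s : 'I_k, (s < t)%N ==> (b s == lab' s)]).
apply/setP => b; rewrite !inE; congr andb; apply: eq_forallb => s.
by case st: (s < t)%N => //=; rewrite E.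
Qed.

(** Each mistake at least halves the version space [V m], which always contains [b]; hence the
    invariant [2 ^ #|M m| * #|V m| <= #|F|]. *)
Lemma vote_mistakes (k : nat) (F : {set {ffun 'I_k -> bool}}) (b : {ffun 'I_k -> bool}) :
  b \in F -> (2 ^ #|finset (fun t => vote F b t != b t)| <= #|F|)%N.
Proof.
move=> bF.
pose V m := finset (fun b' : {ffun 'I_k -> bool} =>
    (b' \in F) && [forall s : 'I_k, (s < m)%N ==> (b' s == b s)]).
pose M m := finset (fun t : 'I_k => (t < m)%N && (vote F b t != b t)).
have inv m : (m <= k)%N -> (2 ^ #|M m| * #|V m| <= #|F|)%N.
  elim: m => [_|m IH mk].
    have -> : M 0%N = finset.set0 by apply/setP => t; rewrite !inE.
    rewrite cards0 mul1n subset_leq_card //.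
    by apply/fintype.subsetP => b'; rewrite inE => /andP[].
  pose t := Ordinal mk.
  have VS : V m.+1 = finset (fun b' => (b' \in V m) && (b' t == b t)).
    apply/setP => b'; rewrite !inE -andbA; congr andb.
    apply/forallP/andP => [h|[/forallP h /eqP ht] s].
      split; last by have := h t; rewrite /= ltnSn.
      by apply/forallP => s; apply/implyP => sm; have /implyP := h s; apply; lia.
    apply/implyP; rewrite ltnS leq_eqVlt => /orP[/eqP st|sm].
      by have -> : s = t by [apply: val_inj]; rewrite ht.
    by have /implyP := h s; apply.
  have [vt|vt] := eqVneq (vote F b t) (b t).
    have -> : M m.+1 = M m.
      apply/setP => s; rewrite !inE ltnS leq_eqVlt.
      have [st|] := eqVneq (s : nat) m; last by [].
      have -> : s = t by apply: val_inj.
      by rewrite vt eqxx !andbF.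
    apply: leq_trans (IH (ltnW mk)); rewrite leq_mul2l; apply/orP; right.
    by rewrite VS subset_leq_card //; apply/fintype.subsetP => b'; rewrite inE => /andP[].
  have -> : M m.+1 = t |: M m.
    apply/setP => s; rewrite !inE ltnS leq_eqVlt -[s == t]val_eqE /=.
    have [st|] := eqVneq (s : nat) m; last by [].
    have -> : s = t by apply: val_inj.
    by rewrite vt.
  rewrite cardsU1 inE ltnn /= add1n expnS mulnC mulnA mulnC.
  apply: leq_trans (IH (ltnW mk)); rewrite leq_mul2l; apply/orP; right.
  rewrite mulnC VS.
  pose c v := #|finset (fun b' => (b' \in V m) && (b' t == v))|.
  have cV : #|V m| = (c true + c false)%N.
    rewrite -(cardsID (finset (fun b' : {ffun 'I_k -> bool} => b' t)) (V m)).
    congr addn; apply: eq_card => b'; rewrite !inE; first by rewrite eqb_id.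
    by rewrite eqbF_neg andbC.
  have voteE : vote F b t = (#|V m| <= 2 * c true)%N.
    rewrite /vote -/(V m); congr (_ <= 2 * _)%N.
    by apply: eq_card => b'; rewrite !inE eqb_id.
  rewrite -/(c (b t)); move: vt; rewrite voteE cV.
  by case: (b t); rewrite ?eqb_id ?eqbF_neg ?negbK; lia.
have -> : finset (fun t => vote F b t != b t) = M k.
  by apply/setP => t; rewrite !inE ltn_ord.
apply: leq_trans (inv k (leqnn k)); rewrite -[X in (X <= _)%N]muln1 leq_mul2l.
apply/orP; right; apply/card_gt0P; exists b; rewrite inE bF /=.
by apply/forallP => s; rewrite eqxx implybT.
Qed.

Definition shattered (X : Type) (P : set (X -> option bool)) (m : nat) (e : 'I_m -> X) :=
  injective e /\
  forall xi : 'I_m -> bool, exists2 g, P g & forall i, g (e i) = Some (xi i).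

Definition VC_le (X : Type) (P : set (X -> option bool)) (d : nat) :=
  forall (m : nat) (e : 'I_m -> X), shattered P e -> (m <= d)%N.

(** A hypothesis that is undefined at one of the points contributes no pattern, so Pajor's lemma for
    total functions applies to partial classes. *)
Definition patterns (X : Type) (P : set (X -> option bool)) (k : nat)
    (pts : 'I_k -> X) : {set {ffun 'I_k -> bool}} :=
  finset (fun b : {ffun 'I_k -> bool} =>
    `[< exists2 g, P g & forall s, g (pts s) = Some (b s) >]).

Lemma patterns_ext (X : Type) (P : set (X -> option bool)) (k : nat)
    (pts pts' : 'I_k -> X) : pts =1 pts' -> patterns P pts = patterns P pts'.
Proof. by move=> E; congr patterns; apply/funext. Qed.

Lemma patterns_shatters (X : Type) (P : set (X -> option bool)) (d k : nat)
    (pts : 'I_k -> X) (A : {set 'I_k}) :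
  VC_le P d -> shatters (patterns P pts) A -> (#|A| <= d)%N.
Proof.
move=> Pd /shattersP sh.
apply: (Pd _ (fun i : 'I_(#|A|) => pts (enum_val i))); split.
  move=> i j ptsE; apply: enum_val_inj.
  (* The points may repeat, but a pattern that is [true] on [enum_val i] and [false] elsewhere on
     [A] cannot come from equal points. *)
  have [b] := sh [ffun s => s == enum_val i].
  rewrite inE => /asboolP[g _ gE] bA.
  have : b (enum_val i) = b (enum_val j).
    by have := gE (enum_val i); rewrite ptsE gE => -[].
  rewrite !bA ?enum_valP // !ffunE eqxx => /esym /eqP.
  by move=> ->.
move=> xi.
have [xi' xiE] : exists xi' : {ffun 'I_k -> bool}, forall i, xi' (enum_val i) = xi i.
  exists [ffun s => [exists i : 'I_(#|A|), (enum_val i == s) && xi i]] => i.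
  rewrite ffunE; apply/existsP/idP => [[j /andP[/eqP/enum_val_inj-> //]]|xii].
  by exists i; rewrite eqxx.
have [b] := sh xi'; rewrite inE => /asboolP[g Pg gE] bA.
by exists g => // i; rewrite gE bA ?enum_valP // xiE.
Qed.

(* The prediction at [x] ignores the whole example [z t] and the labels [(z s).2]
   with [t <= s]. *)
Definition halving (X : Type) (P : set (X -> option bool)) (k : nat)
    (z : 'I_k -> X * bool) (t : 'I_k) (x : X) : bool :=
  vote (patterns P (fun s => if s == t then x else (z s).1)) (fun s => (z s).2) t.

Lemma halving_ext (X : Type) (P : set (X -> option bool)) (k : nat)
    (z z' : 'I_k -> X * bool) (t : 'I_k) (x : X) :
  (forall s, s != t -> z s = z' s) -> halving P z t x = halving P z' t x.
Proof.
move=> E; rewrite /halving.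
rewrite (@patterns_ext _ _ _ _ (fun s => if s == t then x else (z' s).1)); last first.
  by move=> s; case: eqVneq => // st; rewrite E.
by apply: vote_ext => s st; rewrite E // neq_ltn st.
Qed.

(** Each round queries the point of the sample at its own position, so all rounds vote over one set
    [F] of patterns. By Pajor's lemma [#|F|] is at most the number of index sets of size at most
    [d], and [pow_bound] turns this into a quarter of the rounds. *)
Lemma halving_mistakes (X : Type) (P : set (X -> option bool)) (d : nat)
    (z : 'I_(56 * d) -> X * bool) (g : X -> option bool) :
  VC_le P d -> P g -> (forall s, g (z s).1 = Some (z s).2) ->
  (4 * #|finset (fun t => halving P z t (z t).1 != (z t).2)| <= 56 * d)%N.
Proof.
move=> Pd Pg gz.
pose F := patterns P (fun s => (z s).1).
pose b := [ffun s => (z s).2].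
have bF : b \in F.
  by rewrite inE; apply/asboolP; exists g => // s; rewrite ffunE.
have -> : finset (fun t => halving P z t (z t).1 != (z t).2) =
          finset (fun t => vote F b t != b t).
  apply/setP => t; rewrite !inE ffunE /halving.
  rewrite (@patterns_ext _ _ _ _ (fun s => (z s).1)); last first.
    by move=> s; case: eqVneq => // ->.
  by rewrite (@vote_ext _ _ _ b) // => s _; rewrite ffunE.
apply: pow_bound.
have dk : (d <= 56 * d)%N by lia.
apply: leq_trans (card_small_sets dk).
rewrite mulnC leq_mul2l; apply/orP; right.
apply: leq_trans (vote_mistakes bF) _; apply: leq_trans (pajor F) _.
apply: subset_leq_card; apply/fintype.subsetP => A; rewrite !inE.
exact: patterns_shatters.
Qed.

(** * Boosting *)

Definition ffset (k : nat) (T : Type) (z : {ffun 'I_k -> T}) (t : 'I_k) (x : T) :=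
  [ffun s => if s == t then x else z s].

(** Exchangeability: since [f z] ignores [z t], the draw [z t] behaves like a fresh [j]. The weights
    are not normalized, whence the factor on the left. *)
Lemma resample_ffun (F : realFieldType) (J : finType) (k : nat) (t : 'I_k) (w : J -> F)
    (f : {ffun 'I_k -> J} -> J -> F) :
  (forall z i j, f (ffset z t i) j = f z j) ->
  (\sum_j w j) * \sum_(z : {ffun 'I_k -> J}) (\prod_s w (z s)) * f z (z t) =
  \sum_(z : {ffun 'I_k -> J}) (\prod_s w (z s)) * \sum_j w j * f z j.
Proof.
move=> fE; rewrite mulrC big_distrl /=.
under eq_bigr => z _ do rewrite big_distrr /=.
rewrite pair_big /=.
under [RHS]eq_bigr => z _ do rewrite big_distrr /=.
rewrite [RHS]pair_big /=.
(* Exchanging [z t] with [j] preserves the weight of the pair [(z, j)]. *)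
pose sw (u : {ffun 'I_k -> J} * J) := (ffset u.1 t u.2, u.1 t).
have swK : involutive sw.
  case=> z j; rewrite /sw /= ffunE eqxx; congr pair.
  by apply/ffunP => s; rewrite !ffunE; case: eqP => // ->.
rewrite (reindex_inj (inv_inj swK)) /=; apply: eq_bigr => -[z j] _ /=.
rewrite fE ffunE eqxx.
have -> : \prod_s w (ffset z t j s) * f z j * w (z t) =
  (\prod_s w (ffset z t j s) * w (z t)) * f z j by ring.
have -> : \prod_s w (z s) * (w j * f z j) = (\prod_s w (z s) * w j) * f z j by ring.
congr (_ * _); rewrite (bigD1 t) //= [in RHS](bigD1 t) //= ffunE eqxx.
rewrite (eq_bigr (fun s => w (z s))); first by ring.
by move=> s st; rewrite ffunE (negbTE st).
Qed.

Definition wcode (n k : nat) : predArgType := ({ffun 'I_k -> 'I_n} * 'I_k)%type.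

Definition whyp (X : Type) (P : set (X -> option bool)) (n k : nat)
    (S : 'I_n -> X * bool) (c : wcode n k) : X -> bool :=
  halving P (fun s => S (c.1 s)) c.2.

(** Probabilistic method: draw [k] indices with weights [w]. The support of [w] is realizable, so
    [halving_mistakes] bounds the mistakes by [k / 4]; by exchangeability their weighted total
    equals that of the errors on a fresh example. Codes that all erred on more than a quarter of the
    weight would contradict this. *)
Lemma weak_learner (F : realFieldType) (X : Type) (P : set (X -> option bool)) (d n : nat)
    (S : 'I_n -> X * bool) (g : X -> option bool) (w : 'I_n -> F) :
  (0 < d)%N -> (0 < n)%N -> VC_le P d -> P g -> (forall j, 0 <= w j) ->
  (forall j, w j != 0 -> g (S j).1 = Some (S j).2) ->
  exists c : wcode n (56 * d),
    4 * (\sum_j w j * (whyp P S c (S j).1 != (S j).2)%:R) <= \sum_j w j.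
Proof.
move=> d0 n0 Pd Pg w0 gS; set k := (56 * d)%N; set W := \sum_j w j.
have k0 : (0 < k)%N by rewrite /k; lia.
pose z0 : {ffun 'I_k -> 'I_n} := [ffun => Ordinal n0].
pose t0 : 'I_k := Ordinal k0.
pose err (z : {ffun 'I_k -> 'I_n}) (t : 'I_k) j : F :=
  (whyp P S (z, t) (S j).1 != (S j).2)%:R.
have [W0|W0] := eqVneq W 0.
  have w00 j : w j = 0 by have /psumr_eq0P : W = 0 by []; apply.
  by exists (z0, t0); rewrite big1 ?mulr0 ?W0 // => j _; rewrite w00 mul0r.
have Wp : 0 < W by rewrite lt_neqAle eq_sym W0 sumr_ge0.
apply: contrapT => /forallNP no.
have no' (z : {ffun 'I_k -> 'I_n}) (t : 'I_k) : W < 4 * \sum_j w j * err z t j.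
  by rewrite ltNge; apply/negP; exact: no (z, t).
pose pw (z : {ffun 'I_k -> 'I_n}) := \prod_s w (z s).
have pw0 z : 0 <= pw z by apply: prodr_ge0.
have sumpw : \sum_z pw z = W ^+ k.
  have := bigA_distr_bigA (fun (_ : 'I_k) j => w j).
  by move=> <-; rewrite prodr_const card_ord.
have errE t z i j : err (ffset z t i) t j = err z t j.
  rewrite /err /whyp; congr (nat_of_bool (_ != _))%:R; apply: halving_ext => s st.
  by rewrite ffunE (negbTE st).
have mist z : pw z * (4 * \sum_t err z t (z t)) <= pw z * k%:R.
  have [->|pz] := eqVneq (pw z) 0; first by rewrite !mul0r.
  rewrite ler_wpM2l // -natr_sum -[4]/(4%:R) -natrM ler_nat.
  rewrite (_ : (\sum_t _)%N = #|finset (fun t => halving P (fun s => S (z s)) t (S (z t)).1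
     != (S (z t)).2)|); last first.
    rewrite -sum1_card [RHS]big_mkcond /=; apply: eq_bigr => t _.
    by rewrite inE /whyp /=; case: eqP.
  apply: (@halving_mistakes _ P d (fun s => S (z s)) g) => // s; apply: gS.
  by move: pz; rewrite /pw prodf_seq_neq0 => /allP /(_ s); rewrite mem_index_enum => /(_ isT).
have up : W * \sum_z pw z * (4 * \sum_t err z t (z t)) <= W * (W ^+ k * k%:R).
  rewrite ler_wpM2l ?(ltW Wp) // -sumpw mulr_suml; apply: ler_sum => z _; exact: mist.
have lo : W * (W ^+ k * k%:R) < W * \sum_z pw z * (4 * \sum_t err z t (z t)).
  have -> : W * \sum_z pw z * (4 * \sum_t err z t (z t)) =
            \sum_z pw z * \sum_t 4 * \sum_j w j * err z t j.
    transitivity (\sum_t 4 * (W * \sum_z pw z * err z t (z t))).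
      rewrite -big_distrr -big_distrr exchange_big /= !big_distrr /=.
      apply: eq_bigr => z _; rewrite -big_distrr /=; ring.
    transitivity (\sum_t 4 * \sum_z pw z * \sum_j w j * err z t j).
      apply: eq_bigr => t _; congr (4 * _).
      exact: (@resample_ffun _ _ _ t w (fun z j => err z t j) (errE t)).
    rewrite -big_distrr exchange_big /= big_distrr /=; apply: eq_bigr => z _.
    by rewrite -!big_distrr /= mulrCA.
  have -> : W * (W ^+ k * k%:R) = \sum_z pw z * \sum_(t < k) W.
    by rewrite sumr_const card_ord -mulr_suml sumpw -mulr_natr; ring.
  (* The strict inequality requires one tuple [z] of positive weight. *)
  have /psumr_neq0P[|z /andP[_ pz]] : \sum_z pw z <> 0.
  - by apply/eqP; rewrite sumpw expf_neq0.
  - by move=> z _.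
  rewrite (bigD1 z) //= [ltRHS](bigD1 z) //=; apply: ltr_leD.
    rewrite ltr_pM2l //; apply: ltr_sum => //.
    by apply/hasP; exists t0; rewrite ?mem_index_enum.
  by apply: ler_sum => z' _; rewrite ler_wpM2l //; apply: ler_sum => t _; rewrite ltW.
by have := lt_le_trans lo up; rewrite ltxx.
Qed.

Definition mcode (n k T : nat) : predArgType := {ffun 'I_T -> wcode n k}.

(** A tie predicts [false], so [boosting] establishes a strict majority of correct rounds. *)
Definition majority (X : Type) (P : set (X -> option bool)) (n k T : nat)
    (S : 'I_n -> X * bool) (c : mcode n k T) (x : X) : bool :=
  (T < 2 * \sum_(i < T) whyp P S (c i) x)%N.

(** Multiplicative weights: the weight of an example is halved whenever it is classified correctly.
    As the new round errs on at most a quarter of the weight, the potential shrinks by a factor of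
    at most [1 / 2 + 1 / 2 * 1 / 4 = 5 / 8]. *)
Lemma boosting_step (F : realFieldType) (X : Type) (P : set (X -> option bool)) (d n : nat)
    (S : 'I_n -> X * bool) (g : X -> option bool) (T : nat) :
  (0 < d)%N -> (0 < n)%N -> VC_le P d -> P g ->
  exists c : nat -> wcode n (56 * d),
    \sum_(j < n | g (S j).1 == Some (S j).2)
      \prod_(i < T) (if whyp P S (c i) (S j).1 == (S j).2 then 2^-1 else 1 : F)
    <= n%:R * (5 / 8) ^+ T.
Proof.
move=> d0 n0 Pd Pg; elim: T => [|T [c IH]].
  have k0 : (0 < 56 * d)%N by lia.
  exists (fun=> ([ffun => Ordinal n0], Ordinal k0)).
  rewrite expr0 mulr1 (eq_bigr (fun=> 1)); last by move=> j _; rewrite big_ord0.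
  by rewrite sumr_const ler_nat -[leqRHS]card_ord max_card.
pose p j : F := \prod_(i < T) (if whyp P S (c i) (S j).1 == (S j).2 then 2^-1 else 1).
have p0 j : 0 <= p j by apply: prodr_ge0 => i _; case: ifP => _; rewrite ?invr_ge0.
(* Examples off the graph of [g] get weight zero, so that the support is realizable as
   [weak_learner] demands. *)
pose w j := if g (S j).1 == Some (S j).2 then p j else 0.
have [||c' hc'] := @weak_learner F X P d n S g w d0 n0 Pd Pg.
- by move=> j; rewrite /w; case: ifP.
- by move=> j; rewrite /w; case: ifP => [/eqP //|_]; rewrite eqxx.
exists (fun i => if (i < T)%N then c i else c').
have -> : \sum_(j < n | g (S j).1 == Some (S j).2)
      \prod_(i < T.+1) (if whyp P S (if (i < T)%N then c i else c') (S j).1 == (S j).2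
        then 2^-1 else 1 : F) =
    \sum_j w j * (2^-1 + 2^-1 * (whyp P S c' (S j).1 != (S j).2)%:R).
  rewrite big_mkcond /=; apply: eq_bigr => j _; rewrite /w.
  case: ifP => _; last by rewrite mul0r.
  rewrite big_ord_recr /= ltnn; congr (_ * _).
    by apply: eq_bigr => i _; rewrite ltn_ord.
  by case: eqP => _ /=; field.
have pw : \sum_j w j <= n%:R * (5 / 8) ^+ T by rewrite /w -big_mkcond.
rewrite exprSr mulrA.
have -> : \sum_j w j * (2^-1 + 2^-1 * (whyp P S c' (S j).1 != (S j).2)%:R) =
  2^-1 * \sum_j w j + 2^-1 * \sum_j w j * (whyp P S c' (S j).1 != (S j).2)%:R.
  by rewrite !big_distrr -big_split /=; apply: eq_bigr => j _; ring.
lra.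
Qed.

(* Six rounds halve the potential: [(5 / 8)^6 <= 2^-3 / 2]. *)
Lemma potential_lt (F : realFieldType) (n l m : nat) :
  (n < 2 ^ l)%N -> (2 * m <= 6 * l)%N ->
  n%:R * (5 / 8) ^+ (6 * l) < 2^-1 ^+ m :> F.
Proof.
move=> nl ml.
have h0 : (0 : F) <= 2^-1 by rewrite invr_ge0.
have h1 : (2^-1 : F) <= 1 by rewrite invf_le1 ?ler1n.
have half : (2^-1 : F) ^+ (3 * l) <= 2^-1 ^+ m.
  by apply: (ler_wiXn2l h0 h1); rewrite -(leq_pmul2l (isT : (0 < 2)%N)) mulnA.
apply: lt_le_trans half; rewrite !exprM.
have nl' : (n%:R : F) < 2 ^+ l by rewrite -natrX ltr_nat.
have c1 : ((5 / 8 : F) ^+ 6) ^+ l <= ((2^-1 ^+ 3) * 2^-1) ^+ l.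
  by apply: lerXn2r; rewrite ?nnegrE ?exprn_ge0 //; rewrite ?exprS ?expr0; lra.
set h := (_ ^+ 3) ^+ l.
have hp : 0 < h by rewrite !exprn_gt0 ?invr_gt0.
apply: le_lt_trans (ler_wpM2l (ler0n _ n) c1) _.
rewrite exprMn -/h mulrCA gtr_pMr // exprVn ltr_pdivrMr ?mul1r ?exprn_gt0 //.
Qed.

(** An example that at most half of the rounds classify correctly would alone contribute at least
    [2^-1 ^+ m] with [2 * m <= T] to the potential, more than [potential_lt] leaves for the whole
    sample. *)
Lemma boosting (X : Type) (P : set (X -> option bool)) (d n l : nat)
    (S : 'I_n -> X * bool) (g : X -> option bool) :
  (0 < d)%N -> (0 < n)%N -> (n < 2 ^ l)%N -> VC_le P d -> P g ->
  exists c : mcode n (56 * d) (6 * l),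
    forall j, g (S j).1 = Some (S j).2 -> majority P S c (S j).1 = (S j).2.
Proof.
move=> d0 n0 nl Pd Pg; set T := (6 * l)%N.
(* Rational weights suffice, because the conclusion compares only counts. *)
have [c hc] := @boosting_step rat X P d n S g T d0 n0 Pd Pg.
exists [ffun i : 'I_T => c i] => j gj.
pose ok (i : 'I_T) := whyp P S (c i) (S j).1 == (S j).2.
suff big : (T < 2 * \sum_(i < T) ok i)%N.
  rewrite /majority; under eq_bigr => i _ do rewrite ffunE.
  move: big; rewrite /ok; case: (S j).2 => big.
    by under eq_bigr => i _ do rewrite -[whyp _ _ _ _]eqb_id.
  apply/negbTE; rewrite -leqNgt.
  have : (\sum_(i < T) whyp P S (c i) (S j).1 +
         \sum_(i < T) (whyp P S (c i) (S j).1 == false) = T)%N.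
    rewrite -big_split /= (eq_bigr (fun=> 1%N)); last by move=> i _; case: whyp.
    by rewrite sum1_card card_ord.
  move: big; set b := (\sum_(i < T) (_ == _))%N; set a := (\sum_(i < T) _)%N => bT abT.
  have -> : (2 * a <= T)%N by lia.
  by [].
rewrite ltnNge; apply/negP => small.
have : \prod_(i < T) (if ok i then 2^-1 else 1 : rat) <= n%:R * (5 / 8) ^+ T.
  apply: le_trans hc; rewrite [leRHS](bigD1 j) /= ?gj // lerDl.
  by apply: sumr_ge0 => j' _; apply: prodr_ge0 => i _; case: ifP; rewrite ?invr_ge0.
have -> : \prod_(i < T) (if ok i then 2^-1 else 1 : rat) = 2^-1 ^+ (\sum_(i < T) ok i)%N.
  rewrite -prodrXr; apply: eq_bigr => i _; by case: (ok i).
by apply/negP; rewrite -ltNge potential_lt.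
Qed.

Local Open Scope classical_set_scope.
Local Open Scope ring_scope.

(** * Discrete sums and i.i.d. samples *)

Lemma dsum_ge0 (T : Type) (A : set T) (f : T -> \bar R) :
  (forall t, (0 <= f t)%E) -> (0 <= dsum A f)%E.
Proof. by move=> f0; apply: esum_ge0. Qed.

Lemma le_dsum (T : Type) (A : set T) (f g : T -> \bar R) :
  (forall t, A t -> (f t <= g t)%E) -> (dsum A f <= dsum A g)%E.
Proof. by move=> fg; apply: le_esum. Qed.

Lemma eq_dsum (T : Type) (A : set T) (f g : T -> \bar R) :
  (forall t, A t -> f t = g t) -> dsum A f = dsum A g.
Proof. by move=> fg; apply: eq_esum. Qed.

Lemma dsumD (T : Type) (A : set T) (f g : T -> \bar R) :
  (forall t, (0 <= f t)%E) -> (forall t, (0 <= g t)%E) ->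
  dsum A (fun t => f t + g t)%E = (dsum A f + dsum A g)%E.
Proof. by move=> f0 g0; apply: esumD => t _. Qed.

Lemma dsum_sum (T I : Type) (A : set T) (r : seq I) (f : T -> I -> \bar R) :
  (forall t i, (0 <= f t i)%E) ->
  dsum A (fun t => \sum_(i <- r) f t i)%E = (\sum_(i <- r) dsum A (f^~ i))%E.
Proof.
move=> f0; elim: r => [|i r IH].
  by rewrite big_nil [LHS]esum1 // => t _; rewrite big_nil.
rewrite big_cons -IH -dsumD //; last by move=> t; apply: sume_ge0.
by apply: eq_dsum => t _; rewrite big_cons.
Qed.

Lemma dsumZ_le (T : Type) (A : set T) (c : R) (f : T -> \bar R) :
  0 <= c -> (forall t, (0 <= f t)%E) ->
  (dsum A (fun t => c%:E * f t)%E <= c%:E * dsum A f)%E.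
Proof.
move=> c0 f0; apply: ge_ereal_sup => _ [F [finF FA]] <-.
rewrite -ge0_mule_fsumr //.
apply: lee_wpmul2l; first by rewrite lee_fin.
by apply: ereal_sup_ubound; exists F.
Qed.

(** The reverse inequality is [dsumZ_le] applied to the inverse of [c]. *)
Lemma dsumZ (T : Type) (A : set T) (c : R) (f : T -> \bar R) :
  0 <= c -> (forall t, (0 <= f t)%E) ->
  dsum A (fun t => c%:E * f t)%E = (c%:E * dsum A f)%E.
Proof.
move=> c0 f0; apply/eqP; rewrite eq_le dsumZ_le //=.
have [->|cn] := eqVneq c 0.
  by rewrite mul0e; apply: dsum_ge0 => t; rewrite mul0e.
have cp : 0 < c by rewrite lt_neqAle eq_sym cn.
have -> : dsum A f = dsum A (fun t => (c^-1)%:E * (c%:E * f t))%E.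
  by apply: eq_dsum => t _; rewrite muleA -EFinM mulVf // mul1e.
apply: le_trans (lee_wpmul2l _ (dsumZ_le _ _ _)) _.
- by rewrite lee_fin.
- by rewrite invr_ge0.
- by move=> t; rewrite mule_ge0 ?lee_fin.
by rewrite muleA -EFinM mulfV // mul1e.
Qed.

Lemma dsum_mkcond (T : Type) (A : set T) (f : T -> \bar R) :
  dsum A f = dsum setT (fun t => if `[< A t >] then f t else 0%E).
Proof. exact: esum_mkcond. Qed.

Lemma dsum_reindex (T T' : Type) (e : T -> T') (e' : T' -> T) (f : T' -> \bar R) :
  cancel e e' -> cancel e' e ->
  dsum setT f = dsum setT (fun t => f (e t)).
Proof.
move=> eK e'K; apply: (@reindex_esum _ {classic T} {classic T'} setT setT e f).
split => //; first by move=> x y _ _ /(can_inj eK).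
by move=> y _; exists (e' y).
Qed.

Lemma dsum_prod (A B : Type) (f : A * B -> \bar R) :
  (forall ab, (0 <= f ab)%E) ->
  dsum setT f = dsum setT (fun a => dsum setT (fun b => f (a, b))).
Proof.
move=> f0; rewrite /dsum.
rewrite (@esum_esum _ {classic A} {classic B} setT (fun=> setT) (fun a b => f (a, b))) //.
apply: (@reindex_esum _ ({classic A} * {classic B})%type {classic (A * B)}
  (setT `*`` (fun=> setT)) setT (fun k => (k.1, k.2)) f).
split => //; first by move=> [x x'] [y y'] _ _.
by move=> [y y'] _; exists (y, y').
Qed.

Lemma dsum_set1 (T : Type) (u : T) (f : T -> \bar R) :
  (forall t, (0 <= f t)%E) -> dsum [set u] f = f u.
Proof. by move=> f0; apply: esum_set1. Qed.

Lemma dsum_unique (T : Type) (u : T) (f : T -> \bar R) :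
  (forall t, (0 <= f t)%E) -> (forall t, t = u) -> dsum setT f = f u.
Proof.
move=> f0 tu; rewrite -(dsum_set1 u f0); congr dsum.
by apply/seteqP; split => t // _; apply: tu.
Qed.

(** The mass [r] is arbitrary because, besides distributions, the lemma serves the affinity in
    [two_point]. *)
Lemma dsum_prod_pow (Z : Type) (n : nat) (g : Z -> R) (r : R) :
  (forall z, 0 <= g z) -> dsum setT (fun z => (g z)%:E) = r%:E ->
  dsum setT (fun S : 'I_n -> Z => (\prod_(k < n) g (S k))%:E) = (r ^+ n)%:E.
Proof.
move=> g0 gr.
have r0 : 0 <= r by rewrite -lee_fin -gr; apply: dsum_ge0 => z; rewrite lee_fin.
elim: n => [|n IH].
  have u0 : 'I_0 -> Z by case.
  rewrite (@dsum_unique _ u0).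
  - by rewrite big_ord0.
  - by move=> S; rewrite big_ord0 lee_fin.
  - by move=> S; apply/funext; case.
pose e (zS : Z * ('I_n -> Z)) (i : 'I_n.+1) := if unlift ord0 i is Some j then zS.2 j else zS.1.
pose e' (S : 'I_n.+1 -> Z) := (S ord0, fun j => S (lift ord0 j)).
rewrite (@dsum_reindex _ _ e e'); first last.
- by move=> S; apply/funext => i; rewrite /e /e'; case: unliftP => [j|] ->.
- by move=> [z S]; rewrite /e' /e unlift_none; congr pair; apply/funext => j; rewrite liftK.
have pE z S : \prod_(k < n.+1) g (e (z, S) k) = (g z * \prod_(k < n) g (S k))%R.
  rewrite big_ord_recl /e unlift_none; congr (_ * _); apply: eq_bigr => j _.
  by rewrite liftK.
rewrite dsum_prod; last by move=> ab; rewrite lee_fin prodr_ge0.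
under eq_dsum => z _.
  under eq_dsum => S _ do rewrite pE EFinM.
  rewrite dsumZ //; last by move=> S; rewrite lee_fin prodr_ge0.
  rewrite IH muleC; over.
rewrite dsumZ ?exprn_ge0 //.
by rewrite gr -EFinM exprSr.
Qed.

Lemma iid_ge0 (Z : Type) (n : nat) (mu : Z -> R) (S : 'I_n -> Z) :
  (forall z, 0 <= mu z) -> 0 <= iid mu S.
Proof. by move=> mu0; apply: prodr_ge0. Qed.

Lemma iid_dist (Z : Type) (n : nat) (mu : Z -> R) :
  is_dist mu -> is_dist (@iid Z n mu).
Proof.
move=> [mu0 mu1]; split; first by move=> S; apply: iid_ge0.
by rewrite (dsum_prod_pow _ mu0 mu1) expr1n.
Qed.

Definition upd (Z : Type) (n : nat) (S : 'I_n -> Z) (j : 'I_n) (z : Z) : 'I_n -> Z :=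
  fun i => if i == j then z else S i.

Lemma upd_same (Z : Type) (n : nat) (S : 'I_n -> Z) (j : 'I_n) (z : Z) : upd S j z j = z.
Proof. by rewrite /upd eqxx. Qed.

(** The counterpart of [resample_ffun] for discrete distributions: exchanging [S j] with an
    independent draw preserves the joint weight. *)
Lemma resample (Z : Type) (n : nat) (mu : Z -> R) (j : 'I_n) (F : ('I_n -> Z) -> R) :
  is_dist mu -> (forall S, 0 <= F S) ->
  dsum setT (fun S => (iid mu S * F S)%:E) =
  dsum setT (fun S => ((iid mu S)%:E * dsum setT (fun z => (mu z * F (upd S j z))%:E))%E).
Proof.
move=> [mu0 mu1] F0.
have i0 S : 0 <= iid mu S by apply: iid_ge0.
pose G (u : ('I_n -> Z) * Z) := (iid mu u.1 * mu u.2 * F u.1)%:E.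
have G0 u : (0 <= G u)%E by rewrite lee_fin !mulr_ge0.
transitivity (dsum setT G).
  rewrite dsum_prod //; apply: eq_dsum => S _; rewrite /G /=.
  under eq_dsum => z _ do rewrite mulrAC EFinM.
  rewrite dsumZ ?mu1 ?mule1 ?mulr_ge0 // => z; by rewrite lee_fin.
pose sw (u : ('I_n -> Z) * Z) := (upd u.1 j u.2, u.1 j).
have swK : involutive sw.
  case=> S z; rewrite /sw /= upd_same; congr pair.
  by apply/funext => i; rewrite /upd; case: eqP => // ->.
rewrite (@dsum_reindex _ _ sw sw) // dsum_prod //.
apply: eq_dsum => S _; rewrite -dsumZ //; last by move=> z; rewrite lee_fin mulr_ge0.
apply: eq_dsum => z _; rewrite /G /= -EFinM mulrA; congr ((_ * _)%:E).
rewrite /iid (bigD1 j) //= [in RHS](bigD1 j) //= upd_same.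
rewrite (eq_bigr (fun i => mu (S i))); first by ring.
by move=> i ij; rewrite /upd (negbTE ij).
Qed.

(** * Concentration *)

Lemma PrE (T : Type) (p : T -> R) (E : set T) :
  Pr p E = dsum setT (fun t => (p t * (`[< E t >])%:R)%:E).
Proof.
rewrite /Pr dsum_mkcond; apply: eq_dsum => t _.
by case: asboolP => _; rewrite ?mulr1 ?mulr0.
Qed.

Lemma le_Pr (T : Type) (p : T -> R) (E E' : set T) :
  (forall t, 0 <= p t) -> E `<=` E' -> (Pr p E <= Pr p E')%E.
Proof.
move=> p0 EE'; rewrite !PrE; apply: le_dsum => t _.
rewrite lee_fin ler_wpM2l // ler_nat.
by case: asboolP => // /EE' /asboolP ->.
Qed.

Lemma Pr_ge0 (T : Type) (p : T -> R) (E : set T) :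
  (forall t, 0 <= p t) -> (0 <= Pr p E)%E.
Proof. by move=> p0; apply: dsum_ge0 => t; rewrite lee_fin. Qed.

Lemma Pr_le1 (T : Type) (p : T -> R) (E : set T) :
  is_dist p -> (Pr p E <= 1)%E.
Proof. by move=> [p0 <-]; apply: le_Pr. Qed.

Definition prr (T : Type) (p : T -> R) (E : set T) : R := fine (Pr p E).

Lemma EFin_prr (T : Type) (p : T -> R) (E : set T) :
  is_dist p -> (prr p E)%:E = Pr p E.
Proof.
move=> dp; apply: fineK; rewrite ge0_fin_numE; last by apply: Pr_ge0; case: dp.
by apply: le_lt_trans (Pr_le1 E dp) _; rewrite ltry.
Qed.

Lemma prr_ge0 (T : Type) (p : T -> R) (E : set T) : is_dist p -> 0 <= prr p E.
Proof. by move=> dp; rewrite -lee_fin EFin_prr //; apply: Pr_ge0; case: dp. Qed.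

Lemma prr_le1 (T : Type) (p : T -> R) (E : set T) : is_dist p -> prr p E <= 1.
Proof. by move=> dp; rewrite -lee_fin EFin_prr //; apply: Pr_le1. Qed.

Lemma Pr_setC (T : Type) (p : T -> R) (E : set T) :
  is_dist p -> (Pr p E + Pr p (~` E) = 1)%E.
Proof.
move=> [p0 <-]; rewrite !PrE -dsumD.
- apply: eq_dsum => t _; rewrite -EFinD -mulrDr.
  have -> : `[< (~` E) t >] = ~~ `[< E t >] by rewrite /setC /= asbool_neg.
  by case: `[< E t >]; rewrite /= ?addr0 ?add0r mulr1.
- by move=> t; rewrite lee_fin mulr_ge0.
- by move=> t; rewrite lee_fin mulr_ge0.
Qed.

Lemma prr_setC (T : Type) (p : T -> R) (E : set T) :
  is_dist p -> prr p (~` E) = 1 - prr p E.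
Proof.
move=> dp; have := Pr_setC E dp; rewrite -!EFin_prr // -EFinD => -[<-].
by rewrite addrC addKr.
Qed.

Lemma Pr_union_bound (T : Type) (I : finType) (p : T -> R) (E : set T) (Es : I -> set T) :
  (forall t, 0 <= p t) -> (forall t, E t -> exists i, Es i t) ->
  (Pr p E <= \sum_i Pr p (Es i))%E.
Proof.
move=> p0 EEs; rewrite PrE.
under eq_bigr => i _ do rewrite PrE.
rewrite -dsum_sum; last by move=> t i; rewrite lee_fin mulr_ge0.
apply: le_dsum => t _; rewrite sumEFin lee_fin -mulr_sumr ler_wpM2l //.
case: asboolP => [/EEs[i /asboolP Ei]|_]; last by apply: sumr_ge0.
by rewrite (bigD1 i) //= Ei lerDl sumr_ge0.
Qed.

Lemma dsum_two_valued (T : Type) (p : T -> R) (E : set T) (a b : R) :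
  is_dist p -> 0 <= a -> 0 <= b ->
  dsum setT (fun t => (p t * (if `[< E t >] then a else b))%:E) =
  (a * prr p E + b * (1 - prr p E))%:E.
Proof.
move=> dp a0 b0; have [p0 _] := dp.
rewrite -prr_setC // EFinD !EFinM !EFin_prr // !PrE -!dsumZ //.
- rewrite -dsumD.
  + apply: eq_dsum => t _; rewrite -!EFinM -EFinD; congr EFin.
    have -> : `[< (~` E) t >] = ~~ `[< E t >] by rewrite /setC /= asbool_neg.
    by case: `[< E t >] => /=; ring.
  + by move=> t; rewrite -EFinM lee_fin !mulr_ge0.
  + by move=> t; rewrite -EFinM lee_fin !mulr_ge0.
- by move=> t; rewrite lee_fin mulr_ge0.
- by move=> t; rewrite lee_fin mulr_ge0.
Qed.

(** From [1 - x <= expR (- x)] one gets [(1 - x) * expR x <= 1], and [(1 - x) (1 + x + 2 x^2) = 1 +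
    x^2 (1 - 2 x) >= 1]. *)
Lemma expR_le_quadratic (x : R) : x <= 1 / 2 -> expR x <= 1 + x + 2 * x ^+ 2.
Proof.
move=> x2; have h : (1 - x) * expR x <= 1.
  have := expR_ge1Dx (- x); rewrite expRN => h.
  have e0 := expR_gt0 x; rewrite -[leRHS](mulVf (lt0r_neq0 e0)).
  by rewrite ler_wpM2r ?expR_ge0.
have q : 1 <= (1 - x) * (1 + x + 2 * x ^+ 2).
  have -> : (1 - x) * (1 + x + 2 * x ^+ 2) = 1 + x ^+ 2 * (1 - 2 * x) by ring.
  by rewrite lerDl mulr_ge0 ?sqr_ge0 //; lra.
have x1 : 0 < 1 - x by lra.
by rewrite -(ler_pM2l x1); apply: le_trans q.
Qed.

(** In the quadratic bounds the linear terms cancel, which leaves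
    [1 + t^2 * 2 p (1 - p) <= 1 + t^2]. *)
Lemma hoeffding_bernoulli (t p : R) : 0 <= t <= 1 / 2 -> 0 <= p <= 1 ->
  expR (t * (1 - p)) * p + expR (t * (0 - p)) * (1 - p) <= expR (t ^+ 2).
Proof.
move=> /andP[t0 t1] /andP[p0 p1].
have e1 : expR (t * (1 - p)) <= 1 + t * (1 - p) + 2 * (t * (1 - p)) ^+ 2.
  by apply: expR_le_quadratic; nra.
have e0 : expR (t * (0 - p)) <= 1 + t * (0 - p) + 2 * (t * (0 - p)) ^+ 2.
  by apply: expR_le_quadratic; nra.
apply: le_trans (expR_ge1Dx _).
apply: le_trans (lerD (ler_wpM2r p0 e1) (ler_wpM2r _ e0)) _; first by lra.
have -> : (1 + t * (1 - p) + 2 * (t * (1 - p)) ^+ 2) * p +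
  (1 + t * (0 - p) + 2 * (t * (0 - p)) ^+ 2) * (1 - p) = 1 + t ^+ 2 * (2 * p * (1 - p)) by ring.
rewrite lerD2l ler_piMr ?sqr_ge0 //; nra.
Qed.

(** The event [D S] may depend on the sample, but not on its coordinates in [L]; given the other
    coordinates, the indicators over [L] are therefore i.i.d. The induction resamples one coordinate
    of [L] at a time. *)
Lemma chernoff_mgf (Z : Type) (n : nat) (mu : Z -> R) (D : ('I_n -> Z) -> set Z)
    (L : seq 'I_n) (t : R) :
  is_dist mu -> 0 <= t <= 1 / 2 -> uniq L ->
  (forall S j z, j \in L -> D (upd S j z) = D S) ->
  (dsum setT (fun S => (iid mu S *
     \prod_(j <- L) expR (t * ((`[< D S (S j) >])%:R - prr mu (D S))))%:E)
   <= (expR (t ^+ 2) ^+ size L)%:E)%E.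
Proof.
move=> dmu t01; have [mu0 _] := dmu.
elim: L => [_ _|j L IH /= /andP[jL uL] DL].
  under eq_dsum => S _ do rewrite big_nil mulr1.
  by have [_ ->] := iid_dist n dmu; rewrite expr0.
have pos (L' : seq 'I_n) S : 0 <= \prod_(j <- L') expR (t * ((`[< D S (S j) >])%:R - prr mu (D S))).
  by apply: prodr_ge0 => i _; rewrite expR_ge0.
rewrite (resample j) //.
rewrite exprS EFinM; apply: le_trans (lee_wpmul2l _ (IH uL _)); last first.
- by move=> S i z iL; apply: DL; rewrite in_cons iL orbT.
- by rewrite lee_fin expR_ge0.
rewrite -dsumZ ?expR_ge0 //; last by move=> S; rewrite lee_fin mulr_ge0 // iid_ge0.
apply: le_dsum => S _; rewrite -EFinM mulrCA EFinM.
apply: lee_wpmul2l; first by rewrite lee_fin iid_ge0.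
under eq_dsum => z _.
  rewrite big_cons upd_same DL ?mem_head //.
  under eq_big_seq => i iL.
    have ij : (i == j) = false by apply: contraNF jL => /eqP <-.
    rewrite {1}/upd ij; over.
  rewrite mulrA [X in X%:E]mulrC EFinM; over.
rewrite dsumZ //; last by move=> z; rewrite lee_fin mulr_ge0 ?expR_ge0.
rewrite [leRHS]EFinM [leRHS]muleC; apply: lee_wpmul2l; first by rewrite lee_fin.
have p01 : 0 <= prr mu (D S) <= 1 by rewrite prr_ge0 // prr_le1.
apply: le_trans (_ : (_ <= (_)%:E)%E) _; last first.
  rewrite lee_fin; exact: (hoeffding_bernoulli t01 p01).
rewrite -dsum_two_valued ?expR_ge0 //; apply: le_dsum => z _.
by case: asboolP.
Qed.

(** Markov's inequality for the exponential moment; [size L <= n] makes the bound uniform in [L]. *)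
Lemma chernoff (Z : Type) (n : nat) (mu : Z -> R) (D : ('I_n -> Z) -> set Z)
    (L : seq 'I_n) (t a : R) (E : set ('I_n -> Z)) :
  is_dist mu -> 0 <= t <= 1 / 2 -> uniq L ->
  (forall S j z, j \in L -> D (upd S j z) = D S) ->
  (forall S, E S -> a <= \sum_(j <- L) ((`[< D S (S j) >])%:R - prr mu (D S))) ->
  (Pr (iid mu) E <= (expR (n%:R * t ^+ 2 - t * a))%:E)%E.
Proof.
move=> dmu t01 uL DL Ea; have [mu0 _] := dmu; have /andP[t0 _] := t01.
rewrite PrE exp.expRD expRM_natl EFinM muleC.
have sL : (size L <= n)%N by rewrite -[leqRHS]card_ord -(card_uniqP uL) max_card.
apply: le_trans (_ : ((expR (- (t * a)))%:E * (expR (t ^+ 2) ^+ size L)%:E <= _)%E); last first.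
  apply: lee_wpmul2l; first by rewrite lee_fin expR_ge0.
  by rewrite lee_fin ler_weXn2l // -exp.expR0 ler_expR sqr_ge0.
apply: le_trans (lee_wpmul2l _ (chernoff_mgf dmu t01 uL DL)); last by rewrite lee_fin expR_ge0.
rewrite -dsumZ ?expR_ge0 //; last first.
  by move=> S; rewrite lee_fin mulr_ge0 ?iid_ge0 // prodr_ge0 // => i _; rewrite expR_ge0.
apply: le_dsum => S _; rewrite -EFinM lee_fin mulrCA ler_wpM2l ?iid_ge0 //.
rewrite -expR_sum -exp.expRD; case: asboolP => [/Ea ES|_]; last by rewrite expR_ge0.
by rewrite [leLHS]mulr1n -[leLHS]exp.expR0 ler_expR -mulr_sumr addrC subr_ge0 ler_wpM2l ?ES.
Qed.

(** * Empirical risk minimization over codes *)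

Lemma dsum_point (T : Type) (u : T) (F : T -> \bar R) :
  (forall t, (0 <= F t)%E) ->
  dsum setT (fun t => if `[< t = u >] then F t else 0%E) = F u.
Proof. by move=> F0; rewrite -(dsum_set1 u F0) [RHS]dsum_mkcond. Qed.

Definition dirac (T : Type) (u t : T) : R := (`[< t = u >])%:R.

Lemma dirac_dist (T : Type) (u : T) : is_dist (dirac u).
Proof.
split; first by move=> t; rewrite ler0n.
rewrite -[RHS](@dsum_point _ u (fun=> 1%E)) //; apply: eq_dsum => t _.
by rewrite /dirac; case: asboolP.
Qed.

Lemma Pr_deterministic (A B : Type) (p : A -> R) (h : A -> B) (E : set B) :
  (forall a, 0 <= p a) ->
  Pr (fun ab : A * B => (p ab.1 * dirac (h ab.1) ab.2)%R) [set ab | E ab.2] =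
  Pr p [set a | E (h a)].
Proof.
move=> p0; rewrite !PrE dsum_prod; last by move=> ab; rewrite lee_fin !mulr_ge0.
apply: eq_dsum => a _ /=.
rewrite -(@dsum_point _ (h a) (fun b => (p a * (`[< E b >])%:R)%:E)); last first.
  by move=> b; rewrite lee_fin mulr_ge0.
apply: eq_dsum => b _; rewrite /dirac.
by case: asboolP => _; rewrite ?mulr1 // mulr0 mul0r.
Qed.

Definition graph (X : Type) (g : X -> option bool) : set (X * bool) :=
  [set z | g z.1 = Some z.2].

Definition correct (X : Type) (f : X -> bool) : set (X * bool) :=
  [set z | f z.1 = z.2].

Definition score (X : Type) (P : set (X -> option bool)) (n k T : nat)
    (S : 'I_n -> X * bool) (c : mcode n k T) : nat :=
  \sum_(j < n) `[< correct (majority P S c) (S j) >].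

Definition erm_code (X : Type) (P : set (X -> option bool)) (n k T : nat)
    (c0 : mcode n k T) (S : 'I_n -> X * bool) : mcode n k T :=
  [arg max_(c > c0) score P S c].

Lemma erm_code_max (X : Type) (P : set (X -> option bool)) (n k T : nat)
    (c0 : mcode n k T) (S : 'I_n -> X * bool) (c : mcode n k T) :
  (score P S c <= score P S (erm_code P c0 S))%N.
Proof. by rewrite /erm_code; case: arg_maxnP => // c' _; apply. Qed.

(** The compression set of a code: by [majority_upd], changing any other example leaves the
    predictor as it is. *)
Definition used (n k T : nat) (c : mcode n k T) : {set 'I_n} :=
  finset (fun j : 'I_n => [exists i : 'I_T, [exists s : 'I_k, (c i).1 s == j]]).

Lemma card_used (n k T : nat) (c : mcode n k T) : (#|used c| <= T * k)%N.
Proof.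
have -> : used c = imset (fun u : 'I_T * 'I_k => (c u.1).1 u.2) (mem predT).
  apply/setP => j; rewrite inE; apply/existsP/imsetP.
    by case=> i /existsP[s /eqP sj]; exists (i, s).
  by case=> -[i s] _ ->; exists i; apply/existsP; exists s.
apply: leq_trans (leq_imset_card _ _) _.
by rewrite card_prod !card_ord.
Qed.

Lemma majority_upd (X : Type) (P : set (X -> option bool)) (n k T : nat)
    (S : 'I_n -> X * bool) (c : mcode n k T) (j : 'I_n) (z : X * bool) :
  j \notin used c -> majority P (upd S j z) c = majority P S c.
Proof.
move=> jc; apply/funext => x; rewrite /majority.
congr (_ < 2 * _)%N; apply: eq_bigr => i _; congr nat_of_bool.
apply: halving_ext => s _; rewrite /upd ifN //; apply: contraNN jc => /eqP sj.
by rewrite inE; apply/existsP; exists i; apply/existsP; exists s; rewrite sj.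
Qed.


(** The deterministic part. Some code is correct on every example in the graph of [g], so the
    maximal score is at least the number of these. The losses are [eps / 4] for the deviation of
    [g], [eps / 8] for the used examples and [eps / 4] for the deviation on the others. *)
Lemma erm_accurate (X : Type) (P : set (X -> option bool)) (d l : nat)
    (c0 : mcode (2 ^ l) (56 * d) (6 * l.+1)) (mu : X * bool -> R)
    (g : X -> option bool) (eps : R) (S : 'I_(2 ^ l) -> X * bool) :
  (0 < d)%N -> VC_le P d -> P g -> is_dist mu ->
  (6 * l.+1 * (56 * d))%N%:R <= (2 ^ l)%N%:R * (eps / 8) ->
  \sum_(j < 2 ^ l) ((`[< (~` graph g) (S j) >])%:R - prr mu (~` graph g))
    < (2 ^ l)%N%:R * (eps / 4) ->
  (forall c : mcode (2 ^ l) (56 * d) (6 * l.+1),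
    \sum_(j < 2 ^ l | j \notin used c)
      ((`[< correct (majority P S c) (S j) >])%:R - prr mu (correct (majority P S c)))
    < (2 ^ l)%N%:R * (eps / 4)) ->
  prr mu (graph g) - 5 / 8 * eps <= prr mu (correct (majority P S (erm_code P c0 S))).
Proof.
move=> d0 Pd Pg dmu; set n := (2 ^ l)%N => small hg hc.
have n0 : (0 < n)%N by rewrite expn_gt0.
(* [boosting] asks for a strict inequality, hence [l.+1] in the number of rounds. *)
have nl : (n < 2 ^ l.+1)%N by rewrite ltn_exp2l.
have [c' c'P] := boosting S d0 n0 nl Pd Pg.
set c := erm_code P c0 S; set q := prr mu (correct (majority P S c)).
set p := prr mu (graph g).
have q01 : 0 <= q <= 1 by rewrite prr_ge0 // prr_le1.
have gs : \sum_(j < n) (`[< graph g (S j) >])%:R <= (score P S c)%:R :> R.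
  apply: le_trans (_ : _ <= (score P S c')%:R) _; last by rewrite ler_nat erm_code_max.
  rewrite /score natr_sum; apply: ler_sum => j _; rewrite ler_nat.
  case: asboolP => // gj.
  by have /asboolP -> : correct (majority P S c') (S j) by apply: c'P.
have g1 : n%:R * p - n%:R * (eps / 4) <= \sum_(j < n) (`[< graph g (S j) >])%:R.
  (* An upper deviation of the complement is a lower deviation of the graph, so the one-sided
     [chernoff] suffices. *)
  have hE : \sum_(j < n) ((`[< (~` graph g) (S j) >])%:R - prr mu (~` graph g)) =
     n%:R * p - \sum_(j < n) (`[< graph g (S j) >])%:R.
    rewrite (eq_bigr (fun j => p - (`[< graph g (S j) >])%:R)); last first.
      move=> j _; rewrite prr_setC //.
      have -> : `[< (~` graph g) (S j) >] = ~~ `[< graph g (S j) >].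
        by rewrite /setC /= asbool_neg.
      by rewrite -/p; case: `[< _ >] => /=; ring.
    by rewrite sumrB sumr_const card_ord mulr_natl.
  by move: hg; rewrite hE; lra.
have cs : (score P S c)%:R <= n%:R * (eps / 8) + n%:R * (eps / 4) + n%:R * q :> R.
  rewrite /score natr_sum (bigID (mem (used c))) /=.
  have u1 : \sum_(j < n | j \in used c) (`[< correct (majority P S c) (S j) >])%:R
      <= n%:R * (eps / 8).
    apply: le_trans small; apply: le_trans (_ : _ <= (#|used c|)%:R) _; last first.
      by rewrite ler_nat card_used.
    rewrite -sum1_card natr_sum; apply: ler_sum => j _; by case: asboolP.
  have u2 : \sum_(j < n | j \notin used c) (`[< correct (majority P S c) (S j) >])%:R
      <= n%:R * (eps / 4) + n%:R * q.
    have := hc c; rewrite sumrB -/q => h.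
    have : \sum_(j < n | j \notin used c) q <= n%:R * q.
      rewrite sumr_const -[leLHS]mulr_natl ler_wpM2r ?ler_nat //; first by case/andP: q01.
      by rewrite -[leqRHS]card_ord max_card.
    by move: h; rewrite -/n; lra.
  by lra.
have np : (0 : R) < n%:R by rewrite ltr0n.
rewrite -(ler_pM2l np); nra.
Qed.

Definition agnostic_learner (X : Type) (P : set (X -> option bool)) (eps delta : R) (n : nat)
    (A : ('I_n -> X * bool) -> (X -> bool) -> R) : Prop :=
  (forall S, is_dist (A S)) /\
  forall mu : X * bool -> R, is_dist mu ->
    (Pr (fun Sf : ('I_n -> X * bool) * (X -> bool) => (iid mu Sf.1 * A Sf.1 Sf.2)%R)
       [set Sf | (Pr mu (correct Sf.2) >= ereal_sup [set Pr mu (graph g) | g in P] - eps%:E)%E]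
     >= (1 - delta)%:E)%E.

(** A union bound over one failure event for [g] and one per code, whence [1 + #|...|]. For a
    deviation of [n * eps / 4] the exponent [n t^2 - t n eps / 4] is smallest at [t = eps / 8],
    where it equals [- n eps^2 / 64]. *)
Lemma compression_learner (X : Type) (P : set (X -> option bool)) (d l : nat)
    (eps delta : R) :
  (0 < d)%N -> VC_le P d -> (exists g, P g) -> 0 < eps < 1 / 4 ->
  (6 * l.+1 * (56 * d))%N%:R <= (2 ^ l)%N%:R * (eps / 8) ->
  (1 + #|{: mcode (2 ^ l) (56 * d) (6 * l.+1)}|%:R) *
    expR (- ((2 ^ l)%N%:R * eps ^+ 2 / 64)) <= delta ->
  exists A : ('I_(2 ^ l) -> X * bool) -> (X -> bool) -> R, agnostic_learner P eps delta A.
Proof.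
move=> d0 Pd [g1 Pg1] /andP[e0 e4] small; set n := (2 ^ l)%N => bound.
have n0 : (0 < n)%N by rewrite expn_gt0.
have k0 : (0 < 56 * d)%N by lia.
pose c0 : mcode n (56 * d) (6 * l.+1) := [ffun=> ([ffun=> Ordinal n0], Ordinal k0)].
pose erm S := majority P S (erm_code P c0 S).
exists (fun S => dirac (erm S)); split; first by move=> S; apply: dirac_dist.
move=> mu dmu; have [mu0 _] := dmu.
set V := ereal_sup _.
have Vle : (V <= 1)%E by apply: ge_ereal_sup => _ [g _ <-]; apply: Pr_le1.
have Vge : (0 <= V)%E.
  apply: le_trans (Pr_ge0 (graph g1) mu0) _.
  by apply: ereal_sup_ubound; exists g1.
have Vfin : V \is a fin_num by rewrite ge0_fin_numE //; apply: le_lt_trans Vle _; rewrite ltry.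
(* The supremum need not be attained; losing [eps / 8] here and [5 / 8 * eps] in [erm_accurate]
   stays below [eps]. *)
have [g Pg gV] : exists2 g, P g & fine V - eps / 8 < prr mu (graph g).
  have : ((fine V - eps / 8)%:E < V)%E.
    by rewrite -{2}(fineK Vfin) lte_fin ltrBlDr ltrDl divr_gt0.
  move=> /ereal_sup_gt[_ [g Pg <-]]; rewrite -EFin_prr // lte_fin => h.
  by exists g.
rewrite (@Pr_deterministic _ _ (iid mu) erm
  (fun f => (V - eps%:E <= Pr mu (correct f))%E)); last by move=> S; apply: iid_ge0.
have diid := iid_dist n dmu.
set Good := [set S | _].
suff bad : (Pr (iid mu) (~` Good) <= delta%:E)%E.
  rewrite -EFin_prr // lee_fin; move: bad; rewrite -EFin_prr // lee_fin prr_setC //; lra.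
pose t := eps / 8.
have t01 : 0 <= t <= 1 / 2 by rewrite /t; lra.
pose Ei (i : option (mcode n (56 * d) (6 * l.+1))) : set ('I_n -> X * bool) :=
  if i is Some c then
    [set S | n%:R * (eps / 4) <= \sum_(j <- [seq j <- enum 'I_n | j \notin used c])
      ((`[< correct (majority P S c) (S j) >])%:R - prr mu (correct (majority P S c)))]
  else [set S | n%:R * (eps / 4) <= \sum_(j <- enum 'I_n)
      ((`[< (~` graph g) (S j) >])%:R - prr mu (~` graph g))].
apply: le_trans (_ : (\sum_i Pr (iid mu) (Ei i) <= _)%E); last first.
  apply: le_trans (_ : (\sum_(i : option (mcode n (56 * d) (6 * l.+1)))
      (expR (- (n%:R * eps ^+ 2 / 64)))%:E <= _)%E).
    apply: lee_sum => i _.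
    have -> : - (n%:R * eps ^+ 2 / 64) = n%:R * t ^+ 2 - t * (n%:R * (eps / 4)).
      by rewrite /t; field.
    case: i => [c|] /=.
      apply: (@chernoff _ _ mu (fun S => correct (majority P S c))
        [seq j <- enum 'I_n | j \notin used c]) => //.
        by rewrite filter_uniq // enum_uniq.
      by move=> S j z; rewrite mem_filter => /andP[jc _]; rewrite majority_upd.
    by apply: (@chernoff _ _ mu (fun=> ~` graph g) (enum 'I_n)) => //; rewrite enum_uniq.
  rewrite sumEFin lee_fin sumr_const card_option -[leLHS]mulr_natl.
  by rewrite -[X in X%:R * _]add1n natrD.
apply: Pr_union_bound; first by move=> S; apply: iid_ge0.
move=> S nGood; apply: contrapT => /forallNP noE; apply: nGood.
rewrite /Good /= -EFin_prr // -(fineK Vfin) -EFinB lee_fin.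
have := @erm_accurate X P d l c0 mu g eps S d0 Pd Pg dmu small.
rewrite -/n => /(_ _ _) acc.
suff : prr mu (graph g) - 5 / 8 * eps <= prr mu (correct (erm S)) by rewrite /erm; lra.
apply: acc.
  rewrite ltNge; apply/negP => h; apply: (noE None); rewrite /Ei /=.
  by rewrite big_enum.
move=> c; rewrite ltNge; apply/negP => h; apply: (noE (Some c)); rewrite /Ei /=.
by rewrite big_filter big_enum_cond.
Qed.

(** * Choice of the sample size *)

Lemma expR_half_le2 : expR (1 / 2) <= 2 :> R.
Proof. by apply: le_trans (expR_le_quadratic (lexx _)) _; lra. Qed.

Lemma ln2_ge_half : 1 / 2 <= ln 2 :> R.
Proof. by rewrite -ler_expR lnK ?posrE // expR_half_le2. Qed.

Lemma ln_inv_ge1 (delta : R) : 0 < delta < 1 / 4 -> 1 <= ln (1 / delta).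
Proof.
move=> /andP[d0 d4]; rewrite -ler_expR lnK; last by rewrite posrE divr_gt0.
have e1 : 1 = 1 / 2 + 1 / 2 :> R by field.
rewrite [X in expR X]e1 exp.expRD; apply: le_trans (_ : 2 * 2 <= _).
  by apply: ler_pM; rewrite ?expR_ge0 ?expR_half_le2.
by rewrite ler_pdivlMr //; lra.
Qed.

(** Because [1 + x <= (1 + sqrt x)^2]. A square root is the right strength: the bound on [l] gets
    squared and multiplied by [d], which turns [sqrt (D / d)] back into the confidence term [D]. *)
Lemma ln1D_le_sqrt (x : R) : 0 <= x -> ln (1 + x) <= 2 * Num.sqrt x.
Proof.
move=> x0; set y := Num.sqrt x; have y0 : 0 <= y by rewrite sqrtr_ge0.
have -> : x = y ^+ 2 by rewrite sqr_sqrtr.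
apply: le_trans (_ : ln ((1 + y) ^+ 2) <= _).
  by rewrite ler_ln ?posrE; nra.
rewrite lnXn; last by lra.
by rewrite -[leLHS]mulr_natl ler_wpM2l // le_ln1Dx //; lra.
Qed.

Lemma exists_pow2 (x : R) : 1 <= 2 * x ->
  exists l : nat, x <= (2 ^ l)%N%:R <= 2 * x.
Proof.
move=> x1.
have ex : exists l, x <= (2 ^ l)%N%:R.
  exists (Num.bound x); apply: ltW; apply: lt_le_trans (archi_boundP _) _; first by lra.
  by rewrite ler_nat ltnW // ltn_expl.
case: (ex_minnP ex) => l xl lmin; exists l; rewrite xl /=.
case: l xl lmin => [_ _|l xl lmin]; first by rewrite expn0.
rewrite expnS natrM ler_pM2l //.
by rewrite leNgt; apply/negP => /ltW /lmin; rewrite ltnn.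
Qed.

Lemma card_mcode_le (n l k T : nat) : (n = 2 ^ l)%N ->
  (#|{: mcode n k T}| <= 2 ^ (k * l.+1 * T))%N.
Proof.
move=> ->; rewrite card_ffun card_prod card_ffun !card_ord.
have mono a b : (a <= b)%N -> (a ^ T <= b ^ T)%N.
  by case: (T) => // T'; rewrite leq_exp2r.
rewrite [(2 ^ (_ * T))%N]expnM; apply: mono.
have -> : (k * l.+1 = l * k + k)%N by rewrite mulnS addnC mulnC.
by rewrite expnD expnM leq_mul // ltnW // ltn_expl.
Qed.

(** With [u = d / eps] and [x = D / d], the sample size is at most [2 A u^2 L^2 (1 + x)]. Taking
    logarithms, [ln L <= L], [ln (1 + x) <= 2 sqrt x] and [1 / 2 <= ln 2] leave a linear bound in
    [L] and [sqrt x]; [2 <= L] absorbs the constants. *)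
Lemma log_sample_size (A a L D : R) (d l : nat) (eps : R) :
  (0 < d)%N -> 0 < eps < 1 / 4 -> 1 <= D -> 0 < A -> 0 <= a ->
  ln A = a * ln 2 -> L = ln (d%:R / eps) / ln 2 ->
  (2 ^ l)%N%:R <= 2 * (A * ((d%:R * L ^+ 2 + D) / eps ^+ 2)) ->
  2 <= L /\ l.+1%:R <= (a / 2 + 7) * L + 4 * Num.sqrt (D / d%:R).
Proof.
move=> d0 /andP[e0 e4] D1 A0 a0 lnA LE lM.
have l2 := ln2_ge_half; have l20 : 0 < ln 2 :> R by lra.
have d1 : 1 <= d%:R :> R by rewrite ler1n.
set u := d%:R / eps in LE.
have u4 : 2 ^+ 2 <= u by rewrite /u ler_pdivlMr //; nra.
have u0 : 0 < u by nra.
have L2 : 2 <= L.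
  by rewrite LE ler_pdivlMr // mulr_natl -lnXn // ler_ln ?posrE.
split => //.
set x := D / d%:R; have x0 : 0 <= x by rewrite divr_ge0 //; lra.
have lnu : ln u = L * ln 2 by rewrite LE divfK // gt_eqF.
have lnL : ln L <= L by apply/ltW/ln_sublinear; lra.
have lnx := ln1D_le_sqrt x0.
have ML : (d%:R * L ^+ 2 + D) / eps ^+ 2 <= u ^+ 2 * (L ^+ 2 * (1 + x)).
  have -> : u ^+ 2 * (L ^+ 2 * (1 + x)) = (d%:R * (L ^+ 2 * (d%:R + D))) / eps ^+ 2.
    by rewrite /u /x; field; rewrite !gt_eqF //; lra.
  rewrite ler_wpM2r ?invr_ge0 ?sqr_ge0 //.
  have L4 : 1 <= L ^+ 2 by nra.
  have : d%:R * L ^+ 2 <= d%:R * d%:R * L ^+ 2.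
    by rewrite -mulrA ler_peMl // mulr_ge0 // ?sqr_ge0.
  have : D <= d%:R * (L ^+ 2 * D).
    apply: le_trans (_ : L ^+ 2 * D <= _); first by rewrite ler_peMl //; lra.
    by rewrite ler_peMl // mulr_ge0 ?sqr_ge0 //; lra.
  lra.
have : 2 ^+ l <= 2 * (A * (u ^+ 2 * (L ^+ 2 * (1 + x)))).
  rewrite -natrX; apply: le_trans lM _; by rewrite !ler_pM2l.
have L0 : 0 < L by lra.
have x1 : 0 < 1 + x by lra.
have lnsq (v : R) : 0 < v -> ln (v ^+ 2) = 2 * ln v.
  by move=> v0; rewrite lnXn // mulr_natl.
have pL : 0 < L ^+ 2 * (1 + x) by rewrite mulr_gt0 // exprn_gt0.
have pu : 0 < u ^+ 2 * (L ^+ 2 * (1 + x)) by rewrite mulr_gt0 // exprn_gt0.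
have pA : 0 < A * (u ^+ 2 * (L ^+ 2 * (1 + x))) by rewrite mulr_gt0.
have p2 : 0 < 2 * (A * (u ^+ 2 * (L ^+ 2 * (1 + x)))) by rewrite mulr_gt0.
rewrite -ler_ln ?posrE ?exprn_gt0 //.
rewrite [ln (2 ^+ l)]lnXn // (@lnM _ 2) ?posrE // lnM ?posrE // (@lnM _ (u ^+ 2)) ?posrE ?exprn_gt0 //.
rewrite (@lnM _ (L ^+ 2)) ?posrE ?exprn_gt0 // !lnsq // lnA lnu -[X in X <= _]mulr_natl => h.
rewrite -natr1; set s := Num.sqrt x in lnx *.
have s0 : 0 <= s by rewrite sqrtr_ge0.
have h1 : L <= 2 * (L * ln 2) by nra.
have h2 : 2 * s <= 4 * (s * ln 2) by nra.
have h3 : (2 + a) * ln 2 <= (1 + a / 2) * L * ln 2 by rewrite ler_pM2r //; nra.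
rewrite -(ler_pM2r l20); lra.
Qed.

(** There are at most [2 ^ (336 d (l + 1)^2)] codes, while [l] itself is logarithmic in the sample
    size. With [M = (d L^2 + D) / eps^2], a power of two between [A M] and [2 A M] resolves this
    circularity for a large constant [A]. *)
Lemma sample_size (eps delta : R) (d : nat) :
  (0 < d)%N -> 0 < eps < 1 / 4 -> 0 < delta < 1 / 4 ->
  exists l : nat,
    [/\ (6 * l.+1 * (56 * d))%N%:R <= (2 ^ l)%N%:R * (eps / 8),
      (1 + #|{: mcode (2 ^ l) (56 * d) (6 * l.+1)}|%:R) *
        expR (- ((2 ^ l)%N%:R * eps ^+ 2 / 64)) <= delta &
      (2 ^ l)%N%:R <= 2 ^+ 27 * (d%:R / eps ^+ 2 * (ln (d%:R / eps) / ln 2) ^+ 2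
                     + 1 / eps ^+ 2 * ln (1 / delta)) /\ 2 <= d%:R / eps].
Proof.
move=> d0 e14 dl14; have /andP[e0 e4] := e14.
set D := ln (1 / delta); set L := ln (d%:R / eps) / ln 2.
have D1 : 1 <= D by apply: ln_inv_ge1.
have d1 : 1 <= d%:R :> R by rewrite ler1n.
(* For [A = 2 ^ 26] the bound on [l + 1] has coefficient [26 / 2 + 7 = 20]; squaring it and
   multiplying by [336 * 2 = 672] gives the requirement [Abig], which [A] meets. *)
have [A AE] : exists A : R, A = 2 ^+ 26 by eexists.
have A0 : 0 < A by rewrite AE exprn_gt0.
have Abig : 64 * (672 * (20 * 20) + 2) <= A.
  have -> : A = 2 ^+ 8 * 2 ^+ 8 * 2 ^+ 8 * 2 ^+ 2 by rewrite AE -!exprD.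
  have -> : 2 ^+ 8 = 256 :> R by ring.
  lra.
have A1 : 1 <= A by lra.
pose M := (d%:R * L ^+ 2 + D) / eps ^+ 2.
have e20 : 0 < eps ^+ 2 by rewrite exprn_gt0.
have L20 : 0 <= L ^+ 2 by rewrite sqr_ge0.
have M1 : 1 <= M.
  rewrite /M ler_pdivlMr // mul1r; apply: le_trans (_ : 1 <= _); first by nra.
  have : 0 <= d%:R * L ^+ 2 by rewrite mulr_ge0.
  lra.
have [l /andP[lA lM]] : exists l : nat, A * M <= (2 ^ l)%N%:R <= 2 * (A * M).
  apply: exists_pow2; nra.
exists l.
have lnA : ln A = 26 * ln 2 by rewrite AE lnXn // mulr_natl.
have a26 : 0 <= 26 :> R by rewrite ler0n.
have [L2 lb] := log_sample_size d0 e14 D1 A0 a26 lnA erefl lM.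
set s := Num.sqrt (D / d%:R) in lb; rewrite -/L in L2 lb.
have s0 : 0 <= s by rewrite sqrtr_ge0.
have ds2 : d%:R * s ^+ 2 = D.
  rewrite sqr_sqrtr ?divr_ge0 //; last by lra.
  by rewrite mulrC divfK //; lra.
set n := (2 ^ l)%N.
have lb2 : d%:R * l.+1%:R ^+ 2 <= 2 * (20 * 20) * (M * eps ^+ 2).
  have -> : M * eps ^+ 2 = d%:R * L ^+ 2 + D by rewrite /M divfK // gt_eqF.
  apply: le_trans (_ : d%:R * (20 * L + 4 * s) ^+ 2 <= _).
    have Ls0 : 0 <= 20 * L + 4 * s by lra.
    rewrite ler_wpM2l // lerXn2r ?nnegrE //.
    by apply: le_trans lb _; lra.
  (* This is [(x + y)^2 <= 2 x^2 + 2 y^2], and [d s^2 = D] then recovers the confidence term. *)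
  apply: le_trans (_ : d%:R * (2 * (20 * 20) * L ^+ 2 + 32 * s ^+ 2) <= _).
    rewrite ler_wpM2l // -subr_ge0.
    have -> : 2 * (20 * 20) * L ^+ 2 + 32 * s ^+ 2 - (20 * L + 4 * s) ^+ 2 =
      (20 * L - 4 * s) ^+ 2 by ring.
    exact: sqr_ge0.
  rewrite -[X in _ <= _ * (_ + X)]ds2; have := mulr_ge0 (ler0n _ d) (sqr_ge0 s); lra.
have N1 : 336 * (d%:R * l.+1%:R ^+ 2) + 1 + D <= n%:R * eps ^+ 2 / 64.
  have DM : D <= M * eps ^+ 2.
    rewrite /M divfK ?gt_eqF //; have : 0 <= d%:R * L ^+ 2 by rewrite mulr_ge0.
    lra.
  have nM : A * (M * eps ^+ 2) <= n%:R * eps ^+ 2.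
    by rewrite mulrA ler_wpM2r // ltW.
  have AM : 64 * (672 * (20 * 20) + 2) * (M * eps ^+ 2) <= A * (M * eps ^+ 2).
    by rewrite ler_wpM2r //; lra.
  lra.
split.
- rewrite !natrM; apply: le_trans (_ : 336 * (d%:R * l.+1%:R ^+ 2) <= _).
    have l1 : 1 <= l.+1%:R :> R by rewrite ler1n.
    have : d%:R * l.+1%:R <= d%:R * l.+1%:R ^+ 2 :> R by rewrite ler_wpM2l // ler_eXnr.
    lra.
  apply: le_trans (_ : n%:R * (eps * (eps / 64)) <= _); first by lra.
  by rewrite ler_wpM2l // ; nra.
- set N := (56 * d * l.+1 * (6 * l.+1))%N.
  have NE : N%:R = 336 * (d%:R * l.+1%:R ^+ 2) :> R by rewrite /N !natrM; ring.
  have cN : #|{: mcode n (56 * d) (6 * l.+1)}|%:R <= 2 ^+ N :> R.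
    by rewrite -natrX ler_nat; apply: card_mcode_le.
  have e2 : 2 <= expR 1 :> R by apply: le_trans (expR_ge1Dx _); lra.
  have c1 : 1 + #|{: mcode n (56 * d) (6 * l.+1)}|%:R <= expR (N%:R + 1) :> R.
    apply: le_trans (_ : 2 ^+ N.+1 <= _).
      rewrite exprS; have : 1 <= 2 ^+ N :> R by rewrite exprn_ege1 // ler1n.
      lra.
    by rewrite natr1 -[N.+1%:R]mulr1 expRM_natl lerXn2r ?nnegrE ?expR_ge0.
  apply: le_trans (ler_wpM2r (expR_ge0 _) c1) _.
  have /andP[dl0 dl4] := dl14.
  rewrite -exp.expRD -[leRHS]lnK ?posrE // ler_expR.
  have -> : ln delta = - D by rewrite /D div1r lnV ?posrE // opprK.
  rewrite NE; lra.
- split.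
    apply: le_trans lM _.
    have -> : 2 ^+ 27 = 2 * A by rewrite AE -exprS.
    have <- : M = d%:R / eps ^+ 2 * L ^+ 2 + 1 / eps ^+ 2 * D.
      by rewrite /M; field; rewrite gt_eqF.
    by rewrite mulrA.
  rewrite ler_pdivlMr //; nra.
Qed.

(** * Le Cam's two-point inequality *)

Definition mixture (I : finType) (T : Type) (u : I -> T) (w : I -> R) (t : T) : R :=
  \sum_i (`[< t = u i >])%:R * w i.

Lemma mixture_ge0 (I : finType) (T : Type) (u : I -> T) (w : I -> R) (t : T) :
  (forall i, 0 <= w i) -> 0 <= mixture u w t.
Proof. by move=> w0; apply: sumr_ge0 => i _; rewrite mulr_ge0. Qed.

Lemma mixture_at (I : finType) (T : Type) (u : I -> T) (w : I -> R) (i : I) :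
  injective u -> mixture u w (u i) = w i.
Proof.
move=> uI; rewrite /mixture (bigD1 i) //= asboolT // mul1r big1 ?addr0 // => j ji.
by rewrite asboolF ?mul0r // => /uI ij; rewrite ij eqxx in ji.
Qed.

Lemma mixture_out (I : finType) (T : Type) (u : I -> T) (w : I -> R) (t : T) :
  (forall i, t <> u i) -> mixture u w t = 0.
Proof. by move=> tu; rewrite /mixture big1 // => i _; rewrite asboolF // mul0r. Qed.

Lemma dsum_mixture (I : finType) (T : Type) (u : I -> T) (w : I -> R) (F : T -> R) :
  (forall i, 0 <= w i) -> (forall t, 0 <= F t) ->
  dsum setT (fun t => (mixture u w t * F t)%:E) = (\sum_i w i * F (u i))%:E.
Proof.
move=> w0 F0.
under eq_dsum => t _ do rewrite /mixture mulr_suml -sumEFin.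
rewrite dsum_sum; last by move=> t i; rewrite lee_fin !mulr_ge0.
rewrite -sumEFin; apply: eq_bigr => i _.
rewrite -(@dsum_point _ (u i) (fun t => (w i * F t)%:E)); last first.
  by move=> t; rewrite lee_fin mulr_ge0.
by apply: eq_dsum => t _; case: asboolP => _; rewrite ?mul1r ?mul0r.
Qed.

Lemma joint_dist (A B : Type) (p : A -> R) (K : A -> B -> R) :
  is_dist p -> (forall a, is_dist (K a)) ->
  is_dist (fun ab : A * B => (p ab.1 * K ab.1 ab.2)%R).
Proof.
move=> [p0 p1] dK; have K0 a b : 0 <= K a b by case: (dK a).
split; first by move=> ab; rewrite mulr_ge0.
rewrite dsum_prod; last by move=> ab; rewrite lee_fin mulr_ge0.
rewrite -[RHS]p1; apply: eq_dsum => a _ /=.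
under eq_dsum => b _ do rewrite EFinM.
rewrite dsumZ //; last by move=> b; rewrite lee_fin.
by have [_ ->] := dK a; rewrite mule1.
Qed.

Lemma amgm_weighted (p q g t : R) : 0 <= p -> 0 <= q -> 0 <= g -> 0 < t ->
  g ^+ 2 <= p * q -> 2 * g <= p * t + q * t^-1.
Proof.
move=> p0 q0 g0 t0 gpq.
have i0 : 0 < t^-1 by rewrite invr_gt0.
have s0 : 0 <= p * t + q * t^-1 by rewrite addr_ge0 ?mulr_ge0 // ltW.
rewrite -(@ler_pXn2r _ 2) ?nnegrE ?mulr_ge0 //.
have -> : (p * t + q * t^-1) ^+ 2 = (p * t - q * t^-1) ^+ 2 + 4 * (p * q).
  by field; rewrite gt_eqF.
have := sqr_ge0 (p * t - q * t^-1); rewrite exprMn; lra.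
Qed.

(* Le Cam's two-point method, with the affinity bounded below by an explicit [g]. *)
Lemma two_point (Z Y : Type) (n : nat) (p q g : Z -> R) (r t : R)
    (A : ('I_n -> Z) -> Y -> R) (E : set Y) :
  is_dist p -> is_dist q -> (forall z, 0 <= g z) ->
  (forall z, g z ^+ 2 <= p z * q z) ->
  dsum setT (fun z => (g z)%:E) = r%:E ->
  (forall S, is_dist (A S)) -> 0 < t ->
  let err := prr (fun Sf : ('I_n -> Z) * Y => (iid p Sf.1 * A Sf.1 Sf.2)%R) [set Sf | E Sf.2] +
    prr (fun Sf : ('I_n -> Z) * Y => (iid q Sf.1 * A Sf.1 Sf.2)%R) (~` [set Sf | E Sf.2]) in
  2 * r ^+ n <= t * err + t^-1 * (2 - err).
Proof.
move=> dp dq g0 gpq gr dA t0; set Jp := fun Sf => _; set Jq := (fun Sf => _ : R).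
set a1 := prr Jp _; set a2 := prr Jq _ => /=.
have [p0 _] := dp; have [q0 _] := dq; have A0 S y : 0 <= A S y by case: (dA S).
have i0 : 0 < t^-1 by rewrite invr_gt0.
have dJp : is_dist Jp by apply: joint_dist => //; apply: iid_dist.
have dJq : is_dist Jq by apply: joint_dist => //; apply: iid_dist.
(* On the event [t] weighs [p] and [t^-1] weighs [q], off the event the reverse; [amgm_weighted]
   applies pointwise in both cases. *)
have sp := dsum_two_valued [set Sf | E Sf.2] dJp (ltW t0) (ltW i0).
have sq := dsum_two_valued [set Sf | E Sf.2] dJq (ltW i0) (ltW t0).
have a2E : a2 = 1 - prr Jq [set Sf | E Sf.2] by apply: prr_setC.
have sg : dsum setT (fun Sf : ('I_n -> Z) * Y =>
    (2 * (iid g Sf.1 * A Sf.1 Sf.2))%:E) = (2 * r ^+ n)%:E.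
  under eq_dsum => Sf _ do rewrite EFinM.
  rewrite dsumZ //; last by move=> Sf; rewrite lee_fin mulr_ge0 // iid_ge0.
  rewrite EFinM; congr (_ * _)%E.
  rewrite dsum_prod; last by move=> Sf; rewrite lee_fin mulr_ge0 // iid_ge0.
  rewrite -(dsum_prod_pow n g0 gr); apply: eq_dsum => S _ /=.
  under eq_dsum => y _ do rewrite EFinM.
  rewrite dsumZ ?iid_ge0 //; last by move=> y; rewrite lee_fin.
  by have [_ ->] := dA S; rewrite mule1.
rewrite -lee_fin -sg.
have -> : t * (a1 + a2) + t^-1 * (2 - (a1 + a2)) =
    (t * a1 + t^-1 * (1 - a1)) + (t^-1 * prr Jq [set Sf | E Sf.2] +
      t * (1 - prr Jq [set Sf | E Sf.2])) by rewrite a2E; ring.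
rewrite [in leRHS]EFinD -sp -sq -dsumD.
- apply: le_dsum => -[S y] _; rewrite -EFinD lee_fin /Jp /Jq /=.
  have ig0 : 0 <= iid g S by apply: iid_ge0.
  have ip0 : 0 <= iid p S by apply: iid_ge0.
  have iq0 : 0 <= iid q S by apply: iid_ge0.
  have ig : iid g S ^+ 2 <= iid p S * iid q S.
    rewrite /iid -prodrXl -big_split /=; apply: ler_prod => k _.
    by rewrite sqr_ge0 gpq.
  have h1 := amgm_weighted ip0 iq0 ig0 t0 ig.
  have h2 : 2 * iid g S <= iid q S * t + iid p S * t^-1.
    by apply: amgm_weighted => //; rewrite mulrC.
  have Ay := A0 S y.
  case: asboolP => _.
    by have := ler_wpM2r Ay h1; lra.
  by have := ler_wpM2r Ay h2; lra.
- move=> Sf; rewrite lee_fin mulr_ge0 //; first by case: dJp.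
  by case: ifP => _; rewrite ltW.
- move=> Sf; rewrite lee_fin mulr_ge0 //; first by case: dJq.
  by case: ifP => _; rewrite ltW.
Qed.

(** * Hard distributions *)

Definition bias (d : nat) (gamma : R) (sigma : {ffun 'I_d -> bool})
    (kb : 'I_d * bool) : R :=
  ((1 / 2 + (if kb.2 == sigma kb.1 then gamma else - gamma)) / d%:R)%R.

Definition atoms (X : Type) (d : nat) (e : 'I_d -> X) (kb : 'I_d * bool) : X * bool :=
  (e kb.1, kb.2).

Definition hard (X : Type) (d : nat) (e : 'I_d -> X) (gamma : R)
    (sigma : {ffun 'I_d -> bool}) : X * bool -> R :=
  mixture (atoms e) (bias gamma sigma).

Definition flip (d : nat) (sigma : {ffun 'I_d -> bool}) (k : 'I_d) : {ffun 'I_d -> bool} :=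
  [ffun i => if i == k then ~~ sigma i else sigma i].

Lemma flipK (d : nat) (k : 'I_d) : involutive (fun sigma => flip sigma k).
Proof.
by move=> s; apply/ffunP => i; rewrite !ffunE; case: eqP => //; rewrite negbK.
Qed.

Lemma atoms_inj (X : Type) (d : nat) (e : 'I_d -> X) :
  injective e -> injective (atoms e).
Proof. by move=> eI [k b] [k' b'] [/eI -> ->]. Qed.

Lemma bias_ge0 (d : nat) (gamma : R) (sigma : {ffun 'I_d -> bool}) (kb : 'I_d * bool) :
  0 <= gamma <= 1 / 2 -> 0 <= bias gamma sigma kb.
Proof.
move=> /andP[g0 g1]; rewrite /bias divr_ge0 //; case: ifP => _; lra.
Qed.

Lemma sum_bool (f : bool -> R) : \sum_b f b = f true + f false.
Proof. by rewrite (bigD1 true) //= (bigD1 false) //= big1 ?addr0 // => -[]. Qed.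

Lemma sum_bias (d : nat) (gamma : R) (sigma : {ffun 'I_d -> bool}) (k : 'I_d) :
  \sum_b bias gamma sigma (k, b) = 1 / d%:R.
Proof.
by rewrite sum_bool /bias /=; case: (sigma k) => /=; rewrite -mulrDl; congr (_ / _); field.
Qed.

Lemma Pr_mixture (I : finType) (T : Type) (u : I -> T) (w : I -> R) (E : set T) :
  (forall i, 0 <= w i) ->
  Pr (mixture u w) E = (\sum_i w i * (`[< E (u i) >])%:R)%:E.
Proof. by move=> w0; rewrite PrE dsum_mixture. Qed.

Lemma sum_div_card (d : nat) (c : R) : (0 < d)%N -> \sum_(k < d) c / d%:R = c.
Proof.
move=> d0; rewrite sumr_const card_ord -[LHS]mulr_natl mulrC divfK //.
by rewrite pnatr_eq0 -lt0n.
Qed.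

Lemma sum_pairs (d : nat) (f : 'I_d * bool -> R) :
  \sum_kb f kb = \sum_k \sum_b f (k, b).
Proof. by rewrite pair_big /=; apply: eq_bigr => -[k b]. Qed.

Lemma hard_dist (X : Type) (d : nat) (e : 'I_d -> X) (gamma : R)
    (sigma : {ffun 'I_d -> bool}) :
  (0 < d)%N -> 0 <= gamma <= 1 / 2 -> is_dist (hard e gamma sigma).
Proof.
move=> d0 g01; have b0 kb := bias_ge0 sigma kb g01.
split; first by move=> z; apply: mixture_ge0.
have := dsum_mixture (atoms e) (F := fun=> 1) b0 (fun=> ler01).
under eq_dsum => z _ do rewrite mulr1.
move=> ->; congr EFin; under eq_bigr => kb _ do rewrite mulr1.
rewrite sum_pairs -[RHS](sum_div_card _ d0); apply: eq_bigr => k _.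
exact: sum_bias.
Qed.

Lemma Pr_hard_correct (X : Type) (d : nat) (e : 'I_d -> X) (gamma : R)
    (sigma : {ffun 'I_d -> bool}) (f : X -> bool) :
  (0 < d)%N -> 0 <= gamma <= 1 / 2 ->
  Pr (hard e gamma sigma) (correct f) =
  (1 / 2 + gamma - 2 * gamma * (\sum_k (f (e k) != sigma k)%:R / d%:R))%:E.
Proof.
move=> d0 g01; rewrite Pr_mixture; last by move=> kb; apply: bias_ge0.
congr EFin; rewrite sum_pairs.
have h : \sum_(k < d) (1 / 2 + gamma) / d%:R = 1 / 2 + gamma := sum_div_card _ d0.
rewrite -{1}h mulr_sumr -sumrB; apply: eq_bigr => k _.
rewrite sum_bool /bias /atoms /correct /=.
by case: (sigma k); case: (f (e k)); do 2!case: asboolP => //= _; field;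
  rewrite pnatr_eq0 -lt0n.
Qed.

Lemma best_ge_hard (X : Type) (P : set (X -> option bool)) (d : nat) (e : 'I_d -> X)
    (gamma : R) (sigma : {ffun 'I_d -> bool}) :
  (0 < d)%N -> 0 <= gamma <= 1 / 2 -> shattered P e ->
  ((1 / 2 + gamma)%:E <= ereal_sup [set Pr (hard e gamma sigma) (graph g) | g in P])%E.
Proof.
move=> d0 g01 [_ sh]; have [g Pg gE] := sh sigma.
apply: le_trans (_ : Pr (hard e gamma sigma) (graph g) <= _)%E; last first.
  by apply: ereal_sup_ubound; exists g.
rewrite Pr_mixture; last by move=> kb; apply: bias_ge0.
rewrite lee_fin sum_pairs.
have h : \sum_(k < d) (1 / 2 + gamma) / d%:R = 1 / 2 + gamma := sum_div_card _ d0.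
rewrite -h; apply: ler_sum => k _.
rewrite (bigD1 (sigma k)) //= {1}/bias /= eqxx asboolT; last by rewrite /graph /= gE.
by rewrite mulr1 lerDl sumr_ge0 // => b _; rewrite mulr_ge0 // bias_ge0.
Qed.

(** A lower bound for the geometric mean of the two biases that differ by a flip at [k]. They
    coincide away from [k]; at [k] the mean is [sqrt (1 - 4 gamma^2) / (2 d)], and dropping the
    square root only decreases it. *)
Definition affinity (d : nat) (gamma : R) (sigma : {ffun 'I_d -> bool}) (k : 'I_d)
    (kb : 'I_d * bool) : R :=
  if kb.1 == k then ((1 - 4 * gamma ^+ 2) / 2 / d%:R)%R else bias gamma sigma kb.

Lemma affinity_ge0 (d : nat) (gamma : R) (sigma : {ffun 'I_d -> bool}) (k : 'I_d) kb :
  0 <= gamma <= 1 / 2 -> 0 <= affinity gamma sigma k kb.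
Proof.
move=> g01; rewrite /affinity; case: ifP => _; last exact: bias_ge0.
by have /andP[g0 g1] := g01; rewrite !divr_ge0 //; nra.
Qed.

Lemma sum_affinity (d : nat) (gamma : R) (sigma : {ffun 'I_d -> bool}) (k : 'I_d) :
  \sum_kb affinity gamma sigma k kb = 1 - 4 * gamma ^+ 2 / d%:R.
Proof.
have d0 : (0 < d)%N by apply: leq_ltn_trans (ltn_ord k).
have dn : d%:R != 0 :> R by rewrite pnatr_eq0 -lt0n.
rewrite sum_pairs (bigD1 k) //= sum_bool /affinity /= eqxx.
rewrite (eq_bigr (fun=> 1 / d%:R)); last first.
  by move=> i /negbTE ik; rewrite ik sum_bias.
have h : \sum_(k < d) 1 / d%:R = 1 :> R := sum_div_card _ d0.
rewrite (bigD1 k) //= in h.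
have -> : \sum_(i < d | i != k) 1 / d%:R = 1 - 1 / d%:R :> R.
  by apply/eqP; rewrite eq_sym subr_eq addrC; apply/eqP.
by field.
Qed.

Lemma affinity_sq_le (d : nat) (gamma : R) (sigma : {ffun 'I_d -> bool}) (k : 'I_d) kb :
  0 <= gamma <= 1 / 2 ->
  affinity gamma sigma k kb ^+ 2 <= bias gamma sigma kb * bias gamma (flip sigma k) kb.
Proof.
move=> /andP[g0 g1]; have d0 : (0 < d)%N by apply: leq_ltn_trans (ltn_ord k).
have dn : d%:R != 0 :> R by rewrite pnatr_eq0 -lt0n.
rewrite /affinity; case: eqP => [kk|/eqP/negbTE kk].
  have -> : bias gamma sigma kb * bias gamma (flip sigma k) kb =
    (1 - 4 * gamma ^+ 2) / 4 * (d%:R^-1 ^+ 2).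
    rewrite /bias ffunE kk eqxx; case: (sigma k); case: (kb.2) => /=; by field.
  rewrite exprMn ler_wpM2r ?sqr_ge0 //.
  have : 0 <= gamma ^+ 2 by rewrite sqr_ge0.
  have : gamma ^+ 2 <= 1 / 4 by nra.
  nra.
by rewrite /bias ffunE kk expr2.
Qed.

(** Erring at [e k] under the flipped pattern is the complement of erring there under [sigma], so
    [two_point] bounds the sum of both error probabilities. *)
Lemma hard_two_point (X : Type) (d n : nat) (e : 'I_d -> X) (gamma t : R)
    (A : ('I_n -> X * bool) -> (X -> bool) -> R) (sigma : {ffun 'I_d -> bool}) (k : 'I_d) :
  injective e -> 0 <= gamma <= 1 / 2 -> (forall S, is_dist (A S)) -> 0 < t ->
  let err s := prr (fun Sf : ('I_n -> X * bool) * (X -> bool) =>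
    (iid (hard e gamma s) Sf.1 * A Sf.1 Sf.2)%R) [set Sf | Sf.2 (e k) != s k] in
  2 * (1 - 4 * gamma ^+ 2 / d%:R) ^+ n <=
    t * (err sigma + err (flip sigma k)) + t^-1 * (2 - (err sigma + err (flip sigma k))).
Proof.
move=> eI g01 dA t0 /=.
have d0 : (0 < d)%N by apply: leq_ltn_trans (ltn_ord k).
have dh s : is_dist (hard e gamma s) by apply: hard_dist.
have b0 s kb := bias_ge0 s kb g01.
pose g := mixture (atoms e) (affinity gamma sigma k).
have EC : ~` [set Sf : ('I_n -> X * bool) * (X -> bool) | [set f | f (e k) != sigma k] Sf.2] =
  [set Sf | Sf.2 (e k) != flip sigma k k].
  apply/seteqP; split => -[S f] /=; rewrite ffunE eqxx.
    by move/negP; rewrite negbK => /eqP ->; case: (sigma k).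
  by move=> h; apply/negP; rewrite negbK; move: h; case: (f (e k)); case: (sigma k).
have g0 z : 0 <= g z by apply: mixture_ge0 => kb; apply: affinity_ge0.
have gpq z : g z ^+ 2 <= hard e gamma sigma z * hard e gamma (flip sigma k) z.
  have [[kb ->]|/forallNP nz] := pselect (exists kb, z = atoms e kb).
    by rewrite /g /hard !mixture_at; try exact: atoms_inj; apply: affinity_sq_le.
  by rewrite /g /hard !mixture_out // mul0r expr0n.
have gr : dsum setT (fun z => (g z)%:E) = (1 - 4 * gamma ^+ 2 / d%:R)%:E.
  have := dsum_mixture (atoms e) (w := affinity gamma sigma k) (F := fun=> 1)
    (fun kb => affinity_ge0 sigma k kb g01) (fun=> ler01).
  under eq_dsum => z _ do rewrite mulr1.
  move=> ->; congr EFin; under eq_bigr => kb _ do rewrite mulr1.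
  exact: sum_affinity.
by have := two_point [set f | f (e k) != sigma k] (dh _) (dh _) g0 gpq gr dA t0; rewrite EC.
Qed.

Definition run (X : Type) (d n : nat) (e : 'I_d -> X) (gamma : R)
    (A : ('I_n -> X * bool) -> (X -> bool) -> R) (sigma : {ffun 'I_d -> bool})
    (Sf : ('I_n -> X * bool) * (X -> bool)) : R :=
  (iid (hard e gamma sigma) Sf.1 * A Sf.1 Sf.2)%R.

Lemma run_dist (X : Type) (d n : nat) (e : 'I_d -> X) (gamma : R)
    (A : ('I_n -> X * bool) -> (X -> bool) -> R) (sigma : {ffun 'I_d -> bool}) :
  (0 < d)%N -> 0 <= gamma <= 1 / 2 -> (forall S, is_dist (A S)) ->
  is_dist (run e gamma A sigma).
Proof. by move=> d0 g01 dA; apply: joint_dist => //; apply/iid_dist/hard_dist. Qed.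

Lemma learner_on_hard (X : Type) (P : set (X -> option bool)) (eps delta : R) (n d : nat)
    (A : ('I_n -> X * bool) -> (X -> bool) -> R) (e : 'I_d -> X) (gamma : R)
    (sigma : {ffun 'I_d -> bool}) :
  agnostic_learner P eps delta A -> shattered P e -> (0 < d)%N -> 0 <= gamma <= 1 / 2 ->
  1 - delta <= prr (run e gamma A sigma)
    [set Sf | 2 * gamma * (\sum_k (Sf.2 (e k) != sigma k)%:R / d%:R) <= eps].
Proof.
move=> [dA lA] sh d0 g01; have dJ := run_dist e sigma d0 g01 dA.
rewrite -lee_fin EFin_prr //; apply: le_trans (lA _ (hard_dist e sigma d0 g01)) _.
apply: le_Pr; first by case: dJ.
move=> [S f] /=; rewrite Pr_hard_correct //.
have := best_ge_hard sigma d0 g01 sh; set V := ereal_sup _ => hV hf.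
have : ((1 / 2 + gamma)%:E - eps%:E <=
  (1 / 2 + gamma - 2 * gamma * (\sum_k (f (e k) != sigma k)%:R / d%:R))%:E)%E.
  by apply: le_trans hf; apply: leeD2r.
by rewrite -EFinB lee_fin; lra.
Qed.

(** For [gamma = 2 eps] a successful output errs on at most a quarter of the points. Averaging
    [hard_two_point] over all patterns and points then gives [(1 - 16 eps^2 / d) ^ n <= 159 / 160],
    and Bernoulli's inequality concludes with [2560 = 16 * 160]. *)
Lemma sample_lower_dim (X : Type) (P : set (X -> option bool)) (eps delta : R) (n d : nat)
    (A : ('I_n -> X * bool) -> (X -> bool) -> R) (e : 'I_d -> X) :
  0 < eps < 1 / 4 -> delta < 1 / 4 ->
  agnostic_learner P eps delta A -> shattered P e -> (0 < d)%N ->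
  d%:R / eps ^+ 2 <= 2560 * n%:R.
Proof.
move=> /andP[e0 e4] dl4 lA sh d0; have [dA _] := lA; have [eI _] := sh.
have dp : 0 < d%:R :> R by rewrite ltr0n.
have [gamma gE] : exists gamma : R, gamma = 2 * eps by eexists.
have g01 : 0 <= gamma <= 1 / 2 by apply/andP; split; lra.
have dJ s := run_dist (n := n) e s d0 g01 dA.
pose err s k := prr (run e gamma A s) [set Sf | Sf.2 (e k) != s k].
have errs s : \sum_k err s k <= 7 / 16 * d%:R.
  have good := learner_on_hard s lA sh d0 g01.
  set Good := [set Sf | _] in good.
  (* At most [d / 4] points are wrong on [Good] and at most [d] elsewhere. As [Good] has probability
     at least [3 / 4], the expected number is at most [d - 9 / 16 * d]. *)
  have : ((\sum_k err s k + 3 / 4 * d%:R * prr (run e gamma A s) Good)%:E <= d%:R%:E)%E.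
    have [J0 J1] := dJ s; have c0 : 0 <= 3 / 4 * d%:R :> R by lra.
    rewrite EFinD -sumEFin EFinM EFin_prr //.
    under eq_bigr => k _ do rewrite EFin_prr // PrE.
    rewrite PrE -dsum_sum; last by move=> Sf k; rewrite lee_fin mulr_ge0.
    rewrite -dsumZ; first last.
    - by move=> Sf; rewrite lee_fin mulr_ge0.
    - by [].
    rewrite -dsumD; first last.
    - by move=> Sf; rewrite -EFinM lee_fin mulr_ge0 // mulr_ge0.
    - by move=> Sf; apply: sume_ge0 => k _; rewrite lee_fin mulr_ge0.
    have -> : d%:R%:E = dsum setT (fun Sf => (d%:R%:E * (run e gamma A s Sf)%:E)%E).
      by rewrite dsumZ // ?J1 ?mule1 // => Sf; rewrite lee_fin.
    apply: le_dsum => Sf _; rewrite sumEFin -!EFinM -EFinD lee_fin.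
    rewrite -mulr_sumr [leRHS]mulrC mulrCA -mulrDr ler_wpM2l //.
    have -> : \sum_i (`[< (Sf.2 (e i) != s i) >])%:R = \sum_k (Sf.2 (e k) != s k)%:R :> R.
      by apply: eq_bigr => k _; rewrite asboolb.
    set m := \sum_k _.
    case: asboolP => [|_]; last first.
      rewrite mulr0 addr0 /m; apply: le_trans (_ : \sum_(k < d) 1 <= _).
        by apply: ler_sum => k _; rewrite lern1 leq_b1.
      by rewrite sumr_const card_ord.
    rewrite /Good /= -mulr_suml -/m mulrA ler_pdivrMr // gE => h.
    rewrite mulr1; nra.
  rewrite lee_fin.
  have h2 := ler_wpM2l (ltW dp) good; nra.
(* For an average error of [7 / 16] the optimal [t] is [sqrt (9 / 7)]; the nearby rational [6 / 5]
   still makes the right-hand side [159 / 80 < 2]. *)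
have main s k : 2 * (1 - 4 * gamma ^+ 2 / d%:R) ^+ n <=
    6 / 5 * (err s k + err (flip s k) k) + (6 / 5)^-1 * (2 - (err s k + err (flip s k) k)).
  by apply: hard_two_point => //; lra.
have [N [N0 NE]] : exists N : R, 0 < N /\ N = \sum_(s : {ffun 'I_d -> bool}) 1.
  eexists; split; last reflexivity.
  rewrite sumr_const ltr0n; apply/card_gt0P; by exists [ffun=> true].
pose tot := \sum_(s : {ffun 'I_d -> bool}) \sum_k err s k.
have totle : tot <= N * (7 / 16 * d%:R).
  by rewrite NE mulr_suml; apply: ler_sum => s _; rewrite mul1r.
(* Flipping at [k] permutes the patterns, so the flipped errors have the same total. *)
have totf : \sum_(s : {ffun 'I_d -> bool}) \sum_k err (flip s k) k = tot.
  rewrite exchange_big /tot [RHS]exchange_big /=; apply: eq_bigr => k _.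
  by rewrite [RHS](reindex_inj (inv_inj (@flipK d k))).
set G := (1 - _) ^+ n in main.
have sumK (c : R) : \sum_(s : {ffun 'I_d -> bool}) \sum_(k < d) c = N * (d%:R * c).
  rewrite NE mulr_suml; apply: eq_bigr => s _.
  by rewrite sumr_const card_ord mul1r mulr_natl.
have : N * (d%:R * (2 * G)) <= 6 / 5 * (tot + tot) + 5 / 6 * (N * (d%:R * 2) - (tot + tot)).
  rewrite -!sumK -{1 3}totf -!big_split /= -sumrB !mulr_sumr -big_split /=.
  apply: ler_sum => s _.
  rewrite -!big_split /= -sumrB !mulr_sumr -big_split /=.
  by apply: ler_sum => k _; have := main s k; lra.
move=> h; have G1 : G <= 159 / 160.
  have Nd : 0 < N * d%:R by rewrite mulr_gt0.
  rewrite -(ler_pM2l Nd); lra.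
have x01 : 0 <= 4 * gamma ^+ 2 / d%:R <= 1.
  have d1 : 1 <= d%:R :> R by rewrite ler1n.
  apply/andP; split; first by rewrite divr_ge0 // mulr_ge0 // sqr_ge0.
  by rewrite ler_pdivrMr // mul1r gE; nra.
have bern (x : R) (m : nat) : 0 <= x <= 1 -> 1 - m%:R * x <= (1 - x) ^+ m.
  move=> /andP[x0 x1]; elim: m => [|m IH]; first by rewrite mul0r subr0.
  rewrite exprS -natr1; have : 0 <= 1 - x by lra.
  move=> /ler_wpM2l /(_ _ _ IH); have := mulr_ge0 (ler0n R m) (sqr_ge0 x); lra.
have := bern _ n x01; rewrite -/G gE => hb.
have : 1 / 160 <= n%:R * (4 * (2 * eps) ^+ 2 / d%:R) by lra.
rewrite mulrA ler_pdivlMr // => h2.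
rewrite ler_pdivrMr ?exprn_gt0 //; lra.
Qed.

(** With one point and [gamma = eps], a wrong label costs [2 eps > eps], so both patterns have error
    probability at most [delta]. With [s = sqrt delta] and [t = s^-1], [two_point] gives
    [(1 - 4 eps^2) ^ n <= s (2 - s^2)]; logarithms yield [112 = 2 * 7 * 8]. *)
Lemma sample_lower_conf (X : Type) (P : set (X -> option bool)) (eps delta : R) (n : nat)
    (A : ('I_n -> X * bool) -> (X -> bool) -> R) (e : 'I_1 -> X) :
  0 < eps < 1 / 4 -> 0 < delta < 1 / 4 ->
  agnostic_learner P eps delta A -> shattered P e ->
  1 / eps ^+ 2 * ln (1 / delta) <= 112 * n%:R.
Proof.
move=> /andP[e0 e4] /andP[dl0 dl4] lA sh; have [dA _] := lA; have [eI _] := sh.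
have g01 : 0 <= eps <= 1 / 2 by apply/andP; split; lra.
have dJ s := run_dist (n := n) e s (ltn0Sn 0) g01 dA.
pose err s := prr (run e eps A s) [set Sf | Sf.2 (e ord0) != s ord0].
have errs s : err s <= delta.
  have good := learner_on_hard s lA sh (ltn0Sn 0) g01.
  set Good := [set Sf | _] in good.
  apply: le_trans (_ : prr (run e eps A s) (~` Good) <= _); last first.
    by rewrite prr_setC //; lra.
  rewrite -lee_fin !EFin_prr //; apply: le_Pr; first by case: (dJ s).
  move=> Sf /= bad; rewrite /Good /setC /= big_ord1 bad divr1 mulr1.
  by apply/negP; rewrite -ltNge; lra.
have [s [s0 sE]] : exists s : R, 0 <= s /\ s ^+ 2 = delta.
  by exists (Num.sqrt delta); rewrite sqrtr_ge0 sqr_sqrtr // ltW.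
have sp : 0 < s by nra.
have s2 : s < 1 / 2 by nra.
have i0 : 0 < s^-1 by rewrite invr_gt0.
have := @hard_two_point X 1 n e eps s^-1 A [ffun=> true] ord0 eI g01 dA i0 => /=.
rewrite invrK divr1 -/(err _) -/(err _).
set a := err _ + err _; set G := _ ^+ n => h.
have a2 : a <= 2 * s ^+ 2 by rewrite sE /a; have := errs [ffun=> true]; have := errs (flip [ffun=> true] ord0); lra.
have G1 : G <= s * (2 - s ^+ 2).
  have sa : s^-1 * a - s * a <= 2 * s - 2 * s ^+ 3.
    have -> : s^-1 * a - s * a = (s^-1 - s) * a by ring.
    have -> : 2 * s - 2 * s ^+ 3 = (s^-1 - s) * (2 * s ^+ 2) by field; rewrite gt_eqF.
    rewrite ler_wpM2l // subr_ge0.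
    by rewrite -[s^-1]mul1r ler_pdivlMr //; nra.
  lra.
set v := s * (2 - s ^+ 2) in G1.
have v0 : 0 <= v by rewrite mulr_ge0 //; nra.
have v7 : v <= 7 / 8.
  rewrite -subr_ge0.
  have -> : 7 / 8 - v = (1 / 2 - s) * (7 / 4 - 1 / 2 * s - s ^+ 2) by rewrite /v; field.
  by rewrite mulr_ge0 //; nra.
(* The factor [2 - s^2] in [v] is removed at the price of a seventh power: [v <= 7 / 8], the value
   at [s = 1 / 2], and [2 * (7 / 8)^6 <= 1]. *)
have vs : v ^+ 7 <= s.
  rewrite exprSr {2}/v mulrCA -[leRHS]mulr1 ler_wpM2l //.
  apply: le_trans (_ : (7 / 8) ^+ 6 * 2 <= _).
    apply: ler_pM; rewrite ?exprn_ge0 //; [nra | | nra].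
    by rewrite lerXn2r ?nnegrE //; lra.
  by rewrite !exprS expr0; lra.
have u4 : 0 < 1 - 4 * eps ^+ 2 by nra.
have G7 : G ^+ 7 <= s.
  apply: le_trans vs; apply: lerXn2r => //; rewrite nnegrE.
  by rewrite /G exprn_ge0 // ltW.
move: G7; rewrite /G -exprM -ler_ln ?posrE ?exprn_gt0 // lnXn // => hl.
have lns : ln delta = 2 * ln s by rewrite -sE lnXn // mulr_natl.
have lnu : - ln (1 - 4 * eps ^+ 2) <= 8 * eps ^+ 2.
  rewrite -lnV ?posrE //.
  have -> : (1 - 4 * eps ^+ 2)^-1 = 1 + 4 * eps ^+ 2 / (1 - 4 * eps ^+ 2).
    by field; rewrite gt_eqF.
  have q0 : 0 <= 4 * eps ^+ 2 / (1 - 4 * eps ^+ 2).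
    by rewrite divr_ge0 ?mulr_ge0 ?sqr_ge0 // ltW.
  apply: le_trans (le_ln1Dx _) _; first by lra.
  rewrite ler_pdivrMr //; have w0 : 0 <= eps ^+ 2 by rewrite sqr_ge0.
  have w1 : 0 <= 1 / 16 - eps ^+ 2 by nra.
  by have := mulr_ge0 w0 w1; nra.
rewrite [1 / delta]div1r lnV ?posrE // lns mulrAC mul1r ler_pdivrMr ?exprn_gt0 //.
move: hl; rewrite -[leLHS]mulr_natl natrM => hl.
have := ler_wpM2l (ler0n R n) lnu; lra.
Qed.

(** * From tuples of classes to one partial class *)

(** The graph of such a [g] is exactly the agreement event of the tuple [h]; [g] is [None] where the
    [h i] disagree or one of them is undefined. *)
Definition agreement_class (X I : Type) (H : I -> set (X -> option bool)) :
    set (X -> option bool) :=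
  [set g | exists2 h : I -> X -> option bool, (forall i, H i (h i)) &
     forall x y, g x = Some y <-> forall i, h i x = Some y].

(** The index [i0] prevents both labels from being agreed upon vacuously at one point. *)
Lemma agreement_class_intro (X I : Type) (i0 : I) (H : I -> set (X -> option bool))
    (h : I -> X -> option bool) :
  (forall i, H i (h i)) ->
  exists2 g, agreement_class H g & forall x y, g x = Some y <-> forall i, h i x = Some y.
Proof.
move=> Hh.
pose g x := if `[< forall i, h i x = Some true >] then Some true else
            if `[< forall i, h i x = Some false >] then Some false else None.
have gP x y : g x = Some y <-> forall i, h i x = Some y.
  rewrite /g; case: asboolP => [ht|ht].
    by split => [[<-] //|hy]; rewrite -(ht i0).
  case: asboolP => [hf|hf].
    by split => [[<-] //|hy]; rewrite -(hf i0).
  by split => // hy; case: y hy.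
by exists g => //; exists h.
Qed.

Lemma best_agreementE (X I : Type) (i0 : I) (H : I -> set (X -> option bool))
    (mu : X * bool -> R) :
  best_agreement H mu = ereal_sup [set Pr mu (graph g) | g in agreement_class H].
Proof.
congr ereal_sup; apply/seteqP; split => _ [h Hh <-].
  have [g gH gE] := agreement_class_intro i0 Hh; exists g => //; congr Pr.
  by apply/seteqP; split => z; rewrite /graph /= gE.
have [h' Hh' hE] := Hh; exists h' => //; congr Pr.
by apply/seteqP; split => z; rewrite /graph /= hE.
Qed.

(** Choosing a member of every [H i] with the labels [xi] yields one tuple, whose agreed part has
    these labels too; conversely a label of [g] is a label of every [h i]. *)
Lemma shattered_agreement (X I : Type) (i0 : I) (H : I -> set (X -> option bool))
    (d : nat) (e : 'I_d -> X) :
  shattered_by_all H e <-> shattered (agreement_class H) e.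
Proof.
split => -[eI sh]; split => // xi.
  have [h hP] := choice (sh xi).
  have [g gH gE] := agreement_class_intro i0 (fun i => (hP i).1).
  by exists g => // k; apply/gE => i; case: (hP i).
move=> i; have [g [h Hh hE] gxi] := sh xi.
by exists (h i); split => // k; apply/(hE _ _).1/gxi.
Qed.

Lemma agree_learnerE (X I : Type) (i0 : I) (H : I -> set (X -> option bool))
    (eps delta : R) (n : nat) (A : ('I_n -> X * bool) -> (X -> bool) -> R) :
  agree_learner H eps delta A <-> agnostic_learner (agreement_class H) eps delta A.
Proof.
by split => -[dA lA]; split => // mu dmu; have := lA mu dmu;
  rewrite (best_agreementE i0).
Qed.

Lemma VC_le_agreement (X I : Type) (i0 : I) (H : I -> set (X -> option bool)) (d : nat) :
  VC H = (d%:R)%:E -> VC_le (agreement_class H) d.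
Proof.
move=> VCd m e /(shattered_agreement i0) sh.
rewrite -(ler_nat R) -lee_fin -VCd; apply: ereal_sup_ubound.
by exists m => //; exists e.
Qed.

(** An empty class does not even shatter the empty set, so its dimension is the supremum of the
    empty set. *)
Lemma agreement_class_neq0 (X I : Type) (i0 : I) (H : I -> set (X -> option bool)) :
  VC H <> -oo%E -> exists g, agreement_class H g.
Proof.
move=> VCn; apply: contrapT => no; apply: VCn.
rewrite /VC (_ : [set _ | _ in _] = set0) ?ereal_sup0 //.
apply/seteqP; split => // _ [m [e /(shattered_agreement i0)[_ sh]] _] /=.
by have [g Pg _] := sh (fun=> true); apply: no; exists g.
Qed.

(** * Dimension zero and the assembly of both bounds *)

Lemma shattered_point (X : Type) (P : set (X -> option bool)) (d : nat) (e : 'I_d -> X)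
    (k : 'I_d) :
  shattered P e -> shattered P (fun _ : 'I_1 => e k).
Proof.
move=> [eI sh]; split; first by move=> i j _; rewrite (ord1 i) (ord1 j).
move=> xi; have [g Pg gE] := sh (fun=> xi ord0).
by exists g => // i; rewrite gE (ord1 i).
Qed.

Lemma VC0_learner (X : Type) (P : set (X -> option bool)) (eps delta : R) :
  VC_le P 0 -> 0 <= eps -> 0 <= delta ->
  exists A : ('I_0 -> X * bool) -> (X -> bool) -> R, agnostic_learner P eps delta A.
Proof.
move=> P0 e0 dl0.
pose f x := `[< exists2 g, P g & g x = Some true >].
have fP g : P g -> graph g `<=` correct f.
  move=> Pg [x [|]] gx; rewrite /graph /correct /f /= in gx *.
    by apply/asboolP; exists g.
  apply: asboolF => -[g' Pg' g'x].
  suff /P0 : shattered P (fun _ : 'I_1 => x) by [].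
  split; first by move=> i j _; rewrite (ord1 i) (ord1 j).
  move=> xi; case E : (xi ord0); [exists g' | exists g] => // i; by rewrite (ord1 i) E.
exists (fun=> dirac f); split; first by move=> S; apply: dirac_dist.
move=> mu dmu; have [mu0 _] := dmu; have [i0 i1] := iid_dist 0 dmu.
rewrite (@Pr_deterministic _ _ (@iid _ 0 mu) (fun=> f) (fun f =>
  (ereal_sup [set Pr mu (graph g) | g in P] - eps%:E <= Pr mu (correct f))%E)) //.
rewrite (_ : [set _ | _] = setT); first by rewrite /Pr i1 lee_fin; lra.
apply/seteqP; split => // S _ /=.
apply: le_trans (_ : (ereal_sup [set Pr mu (graph g) | g in P] <= _)%E).
  by rewrite geeDl // lee_fin oppr_le0.
by apply: ge_ereal_sup => _ [g Pg <-]; apply: le_Pr => //; apply: fP.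
Qed.

Theorem theoremA2 :
  (exists C : R, 0 < C /\
    forall (X I : Type) (x0 : X) (i0 : I) (H : I -> set (X -> option bool))
           (eps delta : R) (d : nat),
      0 < eps < 1/4 -> 0 < delta < 1/4 ->
      VC H = (d%:R)%:E ->
      exists n : nat, AgreeL_n H eps delta n /\
        n%:R <= C * (d%:R / eps ^+ 2 * (logp (d%:R / eps)) ^+ 2
                     + 1 / eps ^+ 2 * ln (1 / delta))) /\
  (exists c : R, 0 < c /\
    forall (X I : Type) (x0 : X) (i0 : I) (H : I -> set (X -> option bool))
           (eps delta : R) (n : nat),
      0 < eps < 1/4 -> 0 < delta < 1/4 ->
      (1 <= VC H)%E ->
      AgreeL_n H eps delta n ->
      (c%:E * (VC H * (1 / eps ^+ 2)%:E + (1 / eps ^+ 2 * ln (1 / delta))%:E)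
         <= (n%:R)%:E)%E).
Proof.
split.
- exists (2 ^+ 27); split; first by rewrite exprn_gt0.
  move=> X I x0 i0 H eps delta d e14 dl14 VCd.
  have Pd := VC_le_agreement i0 VCd.
  have /andP[e0 e4] := e14; have /andP[dl0 dl4] := dl14.
  have D1 := ln_inv_ge1 dl14.
  case: d VCd Pd => [VCd P0|d VCd Pd].
    have [A lA] := VC0_learner P0 (ltW e0) (ltW dl0).
    exists 0%N; split; first by exists A; apply/(agree_learnerE i0).
    rewrite mul0r mul0r add0r mulr_ge0 ?exprn_ge0 // mulr_ge0 ?divr_ge0 ?exprn_ge0 ?ltW //.
    by lra.
  have [l [small bound [size u2]]] := sample_size (ltn0Sn d) e14 dl14.
  have Pn : exists g, agreement_class H g by apply: (agreement_class_neq0 i0); rewrite VCd.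
  have [A lA] := compression_learner (ltn0Sn d) Pd Pn e14 small bound.
  exists (2 ^ l)%N; split; first by exists A; apply/(agree_learnerE i0).
  (* Since [2 <= d / eps], the truncation in [logp] has no effect. *)
  by rewrite /logp !RdivE max_r.
(* The dimension term is at most [2560 n] and the confidence term at most [112 n], so their sum is
   below [5120 n]. *)
- exists (1 / 5120); split; first by lra.
  move=> X I x0 i0 H eps delta n e14 dl14 VC1 [A /(agree_learnerE i0) lA].
  have /andP[e0 e4] := e14; have /andP[dl0 dl4] := dl14.
  have e20 : 0 < eps ^+ 2 by rewrite exprn_gt0.
  have n0 : 0 <= n%:R :> R by [].
  have c0 : 0 <= 2560 * n%:R :> R by lra.
  (* Bounding all shattered sets at once also shows that the dimension is finite whenever a learner
     exists. *)
  have VCn : (VC H <= (2560 * n%:R * eps ^+ 2)%:E)%E.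
    apply: ge_ereal_sup => _ [d [e /(shattered_agreement i0) sh] <-].
    rewrite lee_fin; case: d e sh => [|d] e sh; first exact: mulr_ge0 c0 (ltW e20).
    by rewrite -ler_pdivrMr //; apply: (sample_lower_dim e14 dl4 lA sh).
  have [e sh] : exists e : 'I_1 -> X, shattered (agreement_class H) e.
    apply: contrapT => no; have : (VC H <= 0)%E.
      apply: ge_ereal_sup => _ [d [e /(shattered_agreement i0) sh] <-].
      case: d e sh => [|d] e sh; first by [].
      by case: no; exists (fun=> e ord0); apply: shattered_point sh.
    by move=> /(le_trans VC1); rewrite lee_fin ler10.
  have conf := sample_lower_conf e14 dl14 lA sh.
  have VCfin : VC H \is a fin_num.
    rewrite ge0_fin_numE; last by apply: le_trans VC1; rewrite lee_fin.
    by apply: le_lt_trans VCn _; rewrite ltry.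
  move: VCn; rewrite -(fineK VCfin) !lee_fin => VCn.
  have dim : fine (VC H) * (1 / eps ^+ 2) <= 2560 * n%:R.
    by rewrite div1r ler_pdivrMr.
  lra.
Qed.
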